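(* Suppose that $1/n<\lambda\to0$ as $n\to\infty$, and that Assumption A2 holds for $c_1,c_2\in(0,\infty]$. Then for any $\varepsilon>0$ there exist positive constants $C_\varepsilon$ and $N_\varepsilon$ such that, with probability greater than $1-e^{-c_1s}-e^{-c_2s_\lambda}$, $$\inf_{n\ge N_\varepsilon}\ \inf_{\substack{f\in\mathcal{B}\\ \|f\|_n\ge C_\varepsilon d_{n,\lambda}}}P_f(\phi_{n,\lambda}=1\mid\boldsymbol{x},S)\ge1-\varepsilon,$$ where $d_{n,\lambda}:=\sqrt{\lambda+\sigma_{n,\lambda}}$, $\mathcal{B}=\{f\in\mathcal{H}:\|f\|_{\mathcal{H}}\le C\}$ for a constant $C$, and $P_f(\cdot\mid\boldsymbol{x},S)$ is the conditional probability measure under $f$ given $\boldsymbol{x}=(x_1,\dots,x_n)$ and $S$.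
   Context: Model: $y_i=f(x_i)+\epsilon_i$, $i=1,\dots,n$, where $x_1,\dots,x_n$ are i.i.d. from a distribution $P_X$ on $\mathcal{X}\subseteq\mathbb{R}^d$ ($d\ge1$ fixed), $\epsilon_i$ are i.i.d. $N(0,1)$ and independent of $(x_1,\dots,x_n)$ and $S$, and $f\in\mathcal{H}$. Kernel: $\mathcal{H}\subset L^2(P_X)$ is an RKHS with inner product $\langle\cdot,\cdot\rangle_{\mathcal{H}}$ and reproducing kernel $K(x,x')=\sum_{i=1}^\infty\mu_i\phi_i(x)\phi_i(x')$, with ordered eigenvalues $\mu_1\ge\mu_2\ge\cdots\ge0$, where $\{\phi_i\}$ is a basis of $L^2(P_X)$ with $\langle\phi_i,\phi_j\rangle_{L^2(P_X)}=\delta_{ij}$ and $\langle\phi_i,\phi_j\rangle_{\mathcal{H}}=\delta_{ij}/\mu_i$. Assumption A1 (standing): $\sup_{i\ge1}\|\phi_i\|_{\sup}<\infty$ and $\sup_{k\ge1}\frac{\sum_{i=k+1}^\infty\mu_i}{k\mu_k}<\infty$. Estimator and test of $H_0:f=0$ versus $H_1:f\in\mathcal{H}\setminus\{0\}$: $\boldsymbol{K}=[n^{-1}K(x_i,x_j)]_{1\le i,j\le n}$, $\boldsymbol{y}=(y_1,\dots,y_n)^\top$; for an $s\times n$ real random matrix $S$, $\widehat\beta=\frac1n(S\boldsymbol{K}^2S^\top+\lambda S\boldsymbol{K}S^\top)^{-1}S\boldsymbol{K}\boldsymbol{y}$, $\widehat f_R(\cdot)=\sum_{i=1}^n(S^\top\widehat\beta)_iK(\cdot,x_i)$,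 $T_{n,\lambda}=\|\widehat f_R\|_n^2$ with $\|g\|_n^2=\frac1n\sum_{i=1}^ng(x_i)^2$. With $\Delta=\boldsymbol{K}S^\top(S\boldsymbol{K}^2S^\top+\lambda S\boldsymbol{K}S^\top)^{-1}S\boldsymbol{K}$, set $\mu_{n,\lambda}=\mathrm{tr}(\Delta^2)/n$ and $\sigma_{n,\lambda}^2=2\,\mathrm{tr}(\Delta^4)/n^2$ with $\sigma_{n,\lambda}\ge0$. The test at significance level $\alpha$ is $\phi_{n,\lambda}=I(|T_{n,\lambda}-\mu_{n,\lambda}|\ge z_{1-\alpha/2}\sigma_{n,\lambda})$, $z_{1-\alpha/2}$ being the $100(1-\alpha/2)$th percentile of $N(0,1)$. Let $\boldsymbol{K}=UDU^\top$, $UU^\top=I_n$, $D=\mathrm{diag}(\widehat\mu_1,\dots,\widehat\mu_n)$, $\widehat\mu_1\ge\cdots\ge\widehat\mu_n\ge0$. Let $\widehat s_\lambda=\min\{i:\widehat\mu_i\le\lambda\}-1$ and $s_\lambda=\min\{i:\mu_i\le\lambda\}-1$. Write $U=(U_1,U_2)$ with $U_1$ the first $\widehat s_\lambda$ columns, and $D_2=\mathrm{diag}(\widehat\mu_{\widehat s_\lambda+1},\dots,\widehat\mu_n)$. $S$ is $\boldsymbol{K}$-satisfiable if there is a constant $c>0$ with $\|(SU_1)^\top SU_1-I_{\widehat s_\lambda}\|_{\mathrm{op}}\le1/2$ and $\|SU_2D_2^{1/2}\|_{\mathrm{op}}\le c\lambda^{1/2}$. An event $\mathcal{E}$ is of $(a,b)$-type,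 $a,b\in(0,\infty]$, if $P(P(\mathcal{E}\mid x_1,\dots,x_n)\ge1-e^{-a})\ge1-e^{-b}$. Assumption A2: (a) $s\ge ds_\lambda$ for a sufficiently large constant $d>0$; (b) there exist $c_1,c_2\in(0,\infty]$ such that the event ''$S$ is $\boldsymbol{K}$-satisfiable'' is of $(c_1s,c_2s_\lambda)$-type.
   Formalization: ''Greater than'' is proved when c_1 and c_2 are both finite; if one is infinite, ''at least'' (with both infinite the claim asks for probability above 1). The bound depends on n, so it is stated for each n ≥ N_ε. The inverse in the estimator is assumed to exist a.s. for large n. *)

(* Defs.v *)
(* Sequences mu_1, mu_2, ... and phi_1, phi_2, ... of the
   mathematics are indexed from 0 here: mu i stands for mu_(i+1). *)
From HB Require Import structures.
From mathcomp Require Import all_boot all_order all_algebra.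
From mathcomp Require Import all_classical all_reals all_analysis.
From mathcomp Require Import measurable_realfun.

Set Implicit Arguments.
Unset Strict Implicit.
Unset Printing Implicit Defensive.
Import Order.TTheory GRing.Theory Num.Theory.
Import numFieldNormedType.Exports.

Local Open Scope classical_set_scope.
Local Open Scope ring_scope.

Definition l2norm (R : realType) (n : nat) (v : 'cV[R]_n) : R :=
  Num.sqrt (\sum_(i < n) v i 0 ^+ 2).

Definition op_norm (R : realType) (m n : nat) (A : 'M[R]_(m, n)) : R :=
  sup [set l2norm (A *m v) | v in [set v : 'cV[R]_n | l2norm v <= 1]].

(* Number of entries of [u] before the first one that is <= l, that is
   min {i >= 1 : u_i <= l} - 1 for a sequence numbered from 1. *)
Definition first_le (R : realType) (u : nat -> R) (l : R) : nat :=
  xget 0%N [set k : nat | u k <= l /\ forall j : nat, (j < k)%N -> l < u j].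

(* K = U D U^T with ordered nonnegative eigenvalues.  [muhat] is extended by 0
   beyond its n entries, so that for l >= 0 the index [first_le muhat l] is n
   when every eigenvalue exceeds l. *)
Definition spectral_decomposition (R : realType) (n : nat) (Kn U : 'M[R]_n)
    (muhat : nat -> R) : Prop :=
  [/\ U *m U^T = 1%:M,
      Kn = U *m diag_mx (\row_(i < n) muhat i) *m U^T,
      forall i j : nat, (i <= j)%N -> muhat j <= muhat i,
      forall i : nat, 0 <= muhat i &
      forall i : nat, (n <= i)%N -> muhat i = 0].

Definition first_cols (R : realType) (n : nat) (U : 'M[R]_n) (k : nat) :
    'M[R]_(n, k) :=
  U *m (\matrix_(i < n, j < k) (i == j :> nat)%:R).

Definition last_cols (R : realType) (n : nat) (U : 'M[R]_n) (k : nat) :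
    'M[R]_(n, n - k) :=
  U *m (\matrix_(i < n, j < n - k) (i == (k + j)%N :> nat)%:R).

(* Neither inequality depends on the choice of the spectral decomposition. *)
Definition K_satisfiable (R : realType) (n s : nat) (c lam : R)
    (Kn : 'M[R]_n) (S : 'M[R]_(s, n)) : Prop :=
  exists (U : 'M[R]_n) (muhat : nat -> R),
    spectral_decomposition Kn U muhat /\
    let k := first_le muhat lam in
    let SU1 := S *m first_cols U k in
    let sqrtD2 := diag_mx (\row_(j < n - k) Num.sqrt (muhat (k + j)%N)) in
    op_norm (SU1^T *m SU1 - 1%:M) <= 2^-1 /\
    op_norm (S *m last_cols U k *m sqrtD2) <= c * Num.sqrt lam.

(* X is a subset of R^d with the trace of the Borel sigma-algebra, and [emb] is
   the inclusion. *)
Definition subspace_of_Rd (R : realType) (d : nat) (dX : measure_display)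
    (X : measurableType dX) (emb : X -> d.-tuple R) : Prop :=
  injective emb /\
  forall A : set X, measurable A <->
    exists2 B : set (d.-tuple R), measurable B & A = emb @^-1` B.

Definition hnorm (R : realType) (X : Type) (ip : (X -> R) -> (X -> R) -> R)
    (f : X -> R) : R := Num.sqrt (ip f f).

Definition is_rkhs (R : realType) (X : Type) (H : set (X -> R))
    (ip : (X -> R) -> (X -> R) -> R) (K : X -> X -> R) : Prop :=
  [/\ [/\ H (fun _ => 0) &
         forall (a : R) (f g : X -> R), H f -> H g ->
           H (fun x => a * f x + g x)],
      [/\ forall f g : X -> R, H f -> H g -> ip f g = ip g f,
         forall (a : R) (f g h : X -> R), H f -> H g -> H h ->
           ip (fun x => a * f x + g x) h = a * ip f h + ip g h,
         forall f : X -> R, H f -> 0 <= ip f f &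
         forall f : X -> R, H f -> ip f f = 0 -> f = (fun _ => 0)],
      forall u : nat -> X -> R, (forall k, H (u k)) ->
        (forall e : R, 0 < e -> exists N : nat, forall k l : nat,
           (N <= k)%N -> (N <= l)%N ->
           hnorm ip (fun x => u k x - u l x) < e) ->
        exists2 f : X -> R, H f &
          hnorm ip (fun x => u k x - f x) @[k --> \oo] --> (0 : R),
      forall x : X, H (K x) &
      forall (f : X -> R) (x : X), H f -> ip f (K x) = f x].

Definition L2_dot (R : realType) (dX : measure_display)
    (X : measurableType dX) (PX : probability X R) (f g : X -> R) : R :=
  (\int[PX]_x (f x * g x))%R.

Definition L2_orthonormal_basis (R : realType) (dX : measure_display)
    (X : measurableType dX) (PX : probability X R) (phi : nat -> X -> R) :
    Prop :=
  [/\ forall i, phi i \in Lfun PX 2%:E,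
      forall i j, L2_dot PX (phi i) (phi j) = (i == j)%:R &
      forall g : X -> R, g \in Lfun PX 2%:E ->
        let r N x := g x - \sum_(i < N) L2_dot PX g (phi i) * phi i x in
        L2_dot PX (r N) (r N) @[N --> \oo] --> (0 : R)].

Definition kernel_model (R : realType) (dX : measure_display)
    (X : measurableType dX) (PX : probability X R) (H : set (X -> R))
    (ip : (X -> R) -> (X -> R) -> R) (K : X -> X -> R)
    (mu : nat -> R) (phi : nat -> X -> R) : Prop :=
  [/\ is_rkhs H ip K /\ (forall f, H f -> f \in Lfun PX 2%:E),
      (forall i j : nat, (i <= j)%N -> mu j <= mu i) /\
        (forall i, 0 <= mu i),
      L2_orthonormal_basis PX phi,
      (forall i, H (phi i)) /\
        (forall i j, ip (phi i) (phi j) = (i == j)%:R / mu i) &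
      forall x x' : X,
        (\sum_(i < N) mu i * phi i x * phi i x') @[N --> \oo] --> K x x'].

Definition assumption_A1 (R : realType) (X : Type) (mu : nat -> R)
    (phi : nat -> X -> R) : Prop :=
  (ereal_sup [set ereal_sup [set `|phi i x|%:E | x in setT] | i in setT]
     < +oo)%E /\
  (ereal_sup [set (\sum_(k.+1 <= i <oo) (mu i)%:E) *
                  ((k.+1%:R * mu k)^-1)%:E | k in setT]
     < +oo)%E.

Section test.
Variables (R : realType) (X : Type) (K : X -> X -> R) (n s : nat).
Variables (lam : R) (x : 'I_n -> X) (S : 'M[R]_(s, n)).

Definition emp_norm (g : X -> R) : R :=
  Num.sqrt (n%:R^-1 * \sum_(i < n) g (x i) ^+ 2).

Definition kernel_mx : 'M[R]_n := \matrix_(i, j) (n%:R^-1 * K (x i) (x j)).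

Definition sketched_mx : 'M[R]_s :=
  S *m (kernel_mx *m kernel_mx) *m S^T + lam *: (S *m kernel_mx *m S^T).

(* [invmx] is the inverse only on [unitmx]: statements using [beta_hat] or
   [Delta] have to assume that [sketched_mx] is invertible. *)
Definition beta_hat (y : 'cV[R]_n) : 'cV[R]_s :=
  n%:R^-1 *: (invmx sketched_mx *m S *m kernel_mx *m y).

Definition f_hat (y : 'cV[R]_n) : X -> R :=
  fun t => \sum_(i < n) (S^T *m beta_hat y) i 0 * K t (x i).

Definition T_stat (y : 'cV[R]_n) : R := emp_norm (f_hat y) ^+ 2.

Definition Delta : 'M[R]_n :=
  kernel_mx *m S^T *m invmx sketched_mx *m S *m kernel_mx.

Definition mu_stat : R := \tr (Delta ^+ 2) / n%:R.

Definition sigma_stat : R := Num.sqrt (2 * \tr (Delta ^+ 4) / n%:R ^+ 2).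

Definition separation : R := Num.sqrt (lam + sigma_stat).

Definition normal_quantile (p : R) : R :=
  inf [set t : R | (p%:E <= normal_prob 0 1 [set u : R | (u <= t)%R])%E].

Definition test (alpha : R) (y : 'cV[R]_n) : bool :=
  normal_quantile (1 - alpha / 2) * sigma_stat <= `|T_stat y - mu_stat|.

Definition alternatives (H : set (X -> R)) (ip : (X -> R) -> (X -> R) -> R)
    (C r : R) : set (X -> R) :=
  [set f : X -> R | [/\ H f, hnorm ip f <= C & r <= emp_norm f]].

Definition response (f : X -> R) (e : n.-tuple R) : 'cV[R]_n :=
  \col_(i < n) (f (x i) + tnth e i).

End test.

Section probability_notions.
Variables (R : realType) (dO : measure_display) (Omega : measurableType dO).
Variable P : probability Omega R.

Definition sigma_family (I : Type) (dT : measure_display)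
    (T : measurableType dT) (Y : I -> Omega -> T) : set (set Omega) :=
  <<s \bigcup_i preimage_set_system setT (Y i) measurable >>.

Definition iid (dT : measure_display) (T : measurableType dT) (n : nat)
    (Y : 'I_n -> Omega -> T) (Q : set T -> \bar R) : Prop :=
  forall A : 'I_n -> set T, (forall i, measurable (A i)) ->
    P (\bigcap_i (Y i @^-1` A i)) = (\prod_(i < n) Q (A i))%E.

Definition independent (F G : set (set Omega)) : Prop :=
  forall A B : set Omega, F A -> G B -> P (A `&` B) = (P A * P B)%E.

Definition cond_prob_version (G : set (set Omega)) (A : set Omega)
    (g : Omega -> \bar R) : Prop :=
  (forall B : set (\bar R), measurable B -> G (g @^-1` B)) /\
  (forall B : set Omega, G B -> \int[P]_(w in B) g w = P (A `&` B))%E.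

(* One probability measure per outcome, a version of P(Y in A | G) for every A
   at once: a regular conditional distribution of Y given G. *)
Definition cond_distribution (dT : measure_display) (T : measurableType dT)
    (G : set (set Omega)) (Y : Omega -> T) (Q : Omega -> probability T R) :
    Prop :=
  forall A : set T, measurable A ->
    cond_prob_version G (Y @^-1` A) (fun w => Q w A).

(* G is the sigma-algebra generated by x_1, ..., x_n; e^(-a) = 0 if a = +oo. *)
Definition ab_type (G : set (set Omega)) (a b : \bar R) (E : set Omega) :
    Prop :=
  measurable E /\
  exists2 g : Omega -> \bar R, cond_prob_version G E g &
    (1 - expeR (- b) <= P [set w | 1 - expeR (- a) <= g w])%E.

End probability_notions.

Section model.
Variables (R : realType) (dO : measure_display) (Omega : measurableType dO).
Variable P : probability Omega R.
Variables (dX : measure_display) (X : measurableType dX).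
Variables (n s : nat) (x : 'I_n -> {RV P >-> X}).
Variables (eps : 'I_n -> {RV P >-> R}) (S : Omega -> 'M[R]_(s, n)).

Definition sample (w : Omega) : 'I_n -> X := fun i => x i w.

Definition noise (w : Omega) : n.-tuple R := [tuple eps i w | i < n].

Definition sigma_x : set (set Omega) := sigma_family (fun i => x i : _ -> X).

Definition sigma_xS : set (set Omega) :=
  <<s sigma_x `|` sigma_family (fun (p : 'I_s * 'I_n) w => S w p.1 p.2) >>.

Definition sampling_model (PX : probability X R) : Prop :=
  [/\ iid P (fun i => x i : _ -> X) PX,
      iid P (fun i => eps i : _ -> R) (normal_prob 0 1),
      forall (j : 'I_s) (k : 'I_n), measurable_fun setT (fun w => S w j k) &
      independent P (sigma_family (fun i => eps i : _ -> R)) sigma_xS].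

(* P_f(test = 1 | x, S) at the outcome w: [Q w] is the conditional distribution
   of the noise given (x, S), hence its image under e |-> f(x) + e is the
   conditional distribution of y under f. *)
Definition cond_power (K : X -> X -> R) (lam alpha : R)
    (Q : Omega -> probability (n.-tuple R) R) (f : X -> R) (w : Omega) :
    \bar R :=
  Q w [set e | test K lam (sample w) (S w) alpha (response (sample w) f e)].

End model.

(* Main.v *)
Require Import Defs.
From HB Require Import structures.
From mathcomp Require Import all_boot all_order all_algebra.
From mathcomp Require Import all_classical all_reals all_analysis.
From mathcomp Require Import measurable_realfun.
From mathcomp Require Import ring lra.
Import Order.TTheory GRing.Theory Num.Theory.
Import numFieldNormedType.Exports.
Local Open Scope classical_set_scope.
Local Open Scope ring_scope.

Set Implicit Arguments.
Unset Strict Implicit.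
Unset Printing Implicit Defensive.

(** Why the theorem holds.

    Write [D] for the smoother [Delta], [F] for the vector of the values
    [f (x i)] and [e] for the noise.  The statistic is [|D (F + e)|^2 / n]
    ([T_statE]), so that, [D] being symmetric,

      [T - mu = (|D F|^2 + 2 <D (D F), e> + (<e, D^2 e> - tr D^2)) / n]

    ([T_stat_expansion]).  Everything is done conditionally on the design and
    the sketch, which are fixed until the very end.

    Signal.  [D F] is a sketched ridge fit of [F].  When the sketch nearly
    preserves the leading eigenvectors of the kernel matrix and damps the other
    ones, some sketched combination of kernel sections fits every function of
    bounded norm with a penalised squared error of order [lam]; the ridge fit
    minimises that criterion, so [|F - D F|^2 / n] is at most a constant times
    [lam] ([sketched_smoother_bias], then [Delta_signal] through the reproducing
    property).  If [|F|^2 / n] exceeds a large multiple of [lam + sigma], then so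
    does [|D F|^2 / n].

    Noise.  Since [D] is a contraction ([ridge_contraction]), the linear term has
    variance at most [4 |D F|^2 / n^2], which is small compared with
    [(|D F|^2 / n)^2] because [|D F|^2 / n] is a large multiple of
    [lam > 1 / n].  The quadratic term has variance of the order of
    [tr (D^4) / n^2 = sigma^2 / 2], small compared with the square of a large
    multiple of [sigma].  Chebyshev's inequality ([quadratic_tail_le]) is
    therefore enough: no limit theorem for the null distribution is involved, and
    the critical value enters only through its absolute value.  The moments come
    from the symmetry of the normal law, which kills all monomials of odd degree
    in some coordinate, and from its second and fourth moments.

    Probability.  Given the design and the sketch, the noise is almost surely a
    standard normal vector, by independence ([cond_noise_std_normal]).  The event
    of the theorem is K-satisfiability minus a null set, and its probability is at
    least [(1 - exp (- c1 s)) (1 - exp (- c2 s_lam))] by [ab_type_probability],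
    which exceeds the required bound by the product of the two exponentials. *)

(** * Euclidean vectors and operator norms *)

(** Common source of the two Cauchy-Schwarz inequalities used below, for column
    vectors and for the inner product of the function space. *)
Lemma discriminant_le (R : realFieldType) (a b c : R) : 0 <= a ->
  (forall t : R, 0 <= t ^+ 2 * a + 2 * t * b + c) -> b ^+ 2 <= a * c.
Proof.
move=> a0 h; have [a00|an0] := eqVneq a 0.
  have [->|b0] := eqVneq b 0; first by rewrite a00 expr0n mul0r.
  have := h (- (c + 1) / (2 * b)); rewrite a00 mulr0 add0r.
  have -> : 2 * (- (c + 1) / (2 * b)) * b + c = -1 by field.
  by rewrite lerNr oppr0 ler10.
have ap : 0 < a by rewrite lt_neqAle eq_sym an0.
have := h (- b / a).
have -> : (- b / a) ^+ 2 * a + 2 * (- b / a) * b + c = (a * c - b ^+ 2) / a.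
  by field.
by rewrite pmulr_lge0 ?invr_gt0// subr_ge0.
Qed.

Section euclid.
Context {R : realType}.

Definition dot {n : nat} (u v : 'cV[R]_n) : R := \sum_(i < n) u i 0 * v i 0.

Definition sqn {n : nat} (v : 'cV[R]_n) : R := dot v v.

Lemma dotC n (u v : 'cV[R]_n) : dot u v = dot v u.
Proof. by apply: eq_bigr => i _; rewrite mulrC. Qed.

Lemma dotDl n (u v w : 'cV[R]_n) : dot (u + v) w = dot u w + dot v w.
Proof. by rewrite -big_split; apply: eq_bigr => i _; rewrite mxE mulrDl. Qed.

Lemma dotZl n a (u v : 'cV[R]_n) : dot (a *: u) v = a * dot u v.
Proof. by rewrite /dot mulr_sumr; apply: eq_bigr => i _; rewrite mxE mulrA. Qed.

Lemma dotNl n (u v : 'cV[R]_n) : dot (- u) v = - dot u v.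
Proof. by rewrite -scaleN1r dotZl mulN1r. Qed.

Lemma dotDr n (u v w : 'cV[R]_n) : dot w (u + v) = dot w u + dot w v.
Proof. by rewrite !(dotC w) dotDl. Qed.

Lemma dotZr n a (u v : 'cV[R]_n) : dot v (a *: u) = a * dot v u.
Proof. by rewrite !(dotC v) dotZl. Qed.

Lemma dotNr n (u v : 'cV[R]_n) : dot v (- u) = - dot v u.
Proof. by rewrite !(dotC v) dotNl. Qed.

Definition dotE := (dotDl, dotDr, dotNl, dotNr, dotZl, dotZr).

Lemma dot_mxE n (u v : 'cV[R]_n) : dot u v = (u^T *m v) 0 0.
Proof. by rewrite mxE; apply: eq_bigr => i _; rewrite mxE. Qed.

Lemma dot_mulmxl m n (A : 'M[R]_(m, n)) u v :
  dot (A *m u) v = dot u (A^T *m v).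
Proof. by rewrite !dot_mxE trmx_mul mulmxA. Qed.

Lemma sqn_ge0 n (v : 'cV[R]_n) : 0 <= sqn v.
Proof. by apply: sumr_ge0 => i _; rewrite -expr2 sqr_ge0. Qed.

Lemma sqnE n (v : 'cV[R]_n) : sqn v = \sum_(i < n) v i 0 ^+ 2.
Proof. by apply: eq_bigr => i _; rewrite expr2. Qed.

Lemma sqn_eq0 n (v : 'cV[R]_n) : sqn v = 0 -> v = 0.
Proof.
move=> /eqP; rewrite sqnE psumr_eq0 => [/allP h|i _]; last exact: sqr_ge0.
apply/matrixP => i j; rewrite ord1 mxE.
by have /= := h i (mem_index_enum _); rewrite sqrf_eq0 => /eqP.
Qed.

Lemma dot_CauchySchwarz n (u v : 'cV[R]_n) : dot u v ^+ 2 <= sqn u * sqn v.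
Proof.
apply: discriminant_le => [|t]; first exact: sqn_ge0.
have := sqn_ge0 (t *: u + v); rewrite /sqn !dotE (dotC v u); congr (_ <= _).
by ring.
Qed.

Lemma l2norm_ge0 n (v : 'cV[R]_n) : 0 <= l2norm v.
Proof. exact: sqrtr_ge0. Qed.

Lemma sqr_l2norm n (v : 'cV[R]_n) : l2norm v ^+ 2 = sqn v.
Proof. by rewrite /l2norm -sqnE sqr_sqrtr// sqn_ge0. Qed.

Lemma l2normZ n a (v : 'cV[R]_n) : l2norm (a *: v) = `|a| * l2norm v.
Proof.
rewrite /l2norm -!sqnE /sqn !dotE mulrA -expr2 sqrtrM ?sqr_ge0//.
by rewrite sqrtr_sqr.
Qed.

Lemma l2norm0 n : l2norm (0 : 'cV[R]_n) = 0.
Proof. by rewrite -(scale0r (0 : 'cV_n)) l2normZ normr0 mul0r. Qed.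

Lemma sqn_mulmx_bounded m n (A : 'M[R]_(m, n)) :
  exists b : R, 0 <= b /\ forall v, sqn (A *m v) <= b * sqn v.
Proof.
exists (\sum_(i < m) sqn (row i A)^T); split.
  by apply: sumr_ge0 => i _; exact: sqn_ge0.
move=> v; rewrite sqnE mulr_suml; apply: ler_sum => i _.
have -> : (A *m v) i 0 = dot (row i A)^T v.
  by rewrite mxE; apply: eq_bigr => j _; rewrite !mxE.
exact: dot_CauchySchwarz.
Qed.

(** The set whose supremum is [op_norm] is bounded, by the Frobenius norm; the
    supremum of an unbounded set would be the default value 0. *)
Lemma op_norm_ub m n (A : 'M[R]_(m, n)) w :
  l2norm w <= 1 -> l2norm (A *m w) <= op_norm A.
Proof.
  have [b [b0 hb]] := sqn_mulmx_bounded A.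
  move=> w1; apply: sup_upper_bound; last by exists w.
  split; first by exists (l2norm (A *m w)), w.
  exists (Num.sqrt b) => _ [u /= u1 <-].
  rewrite /l2norm -sqnE ler_sqrt//; apply: le_trans (hb u) _.
  rewrite -[leRHS]mulr1 ler_wpM2l// -sqr_l2norm expr_le1//.
  exact: l2norm_ge0.
Qed.

Lemma op_norm_ge0 m n (A : 'M[R]_(m, n)) : 0 <= op_norm A.
Proof.
by apply: le_trans (op_norm_ub A (w := 0) _); rewrite ?l2norm_ge0 ?l2norm0.
Qed.

Lemma op_normP m n (A : 'M[R]_(m, n)) v :
  l2norm (A *m v) <= op_norm A * l2norm v.
Proof.
have [v0|v0] := eqVneq (l2norm v) 0.
  have /sqn_eq0 -> : sqn v = 0 by rewrite -sqr_l2norm v0 expr0n.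
  by rewrite mulmx0 !l2norm0 mulr0.
have vp : 0 < l2norm v by rewrite lt_neqAle eq_sym v0 l2norm_ge0.
have := @op_norm_ub _ _ A ((l2norm v)^-1 *: v).
rewrite -scalemxAr !l2normZ ger0_norm ?invr_ge0 ?l2norm_ge0// mulVf//.
by move=> /(_ (lexx _)); rewrite mulrC ler_pdivrMr.
Qed.

Lemma op_norm_sqn m n (A : 'M[R]_(m, n)) (b : R) v :
  op_norm A <= b -> sqn (A *m v) <= b ^+ 2 * sqn v.
Proof.
move=> Ab; rewrite -!sqr_l2norm -exprMn ler_pXn2r ?nnegrE ?l2norm_ge0//.
- apply: le_trans (op_normP A v) _.
  by apply: ler_wpM2r => //; exact: l2norm_ge0.
- apply: mulr_ge0; last exact: l2norm_ge0.
  by apply: le_trans Ab; exact: op_norm_ge0.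
Qed.

(** Cauchy-Schwarz in [|A^T w|^2 = <w, A (A^T w)>], followed by a division by
    [|A^T w|^2]. *)
Lemma sqn_trmx_le m n (A : 'M[R]_(m, n)) (b : R) : 0 <= b ->
  (forall v, sqn (A *m v) <= b * sqn v) -> forall w, sqn (A^T *m w) <= b * sqn w.
Proof.
move=> b0 hA w; set q := sqn (A^T *m w).
have q0 : 0 <= q := sqn_ge0 _.
have : q ^+ 2 <= sqn w * (b * q).
  rewrite {1}/q {1}/sqn dot_mulmxl trmxK.
  apply: le_trans (dot_CauchySchwarz _ _) _.
  by apply: ler_wpM2l; [exact: sqn_ge0|exact: hA].
have [->|qn0] := eqVneq q 0; first by rewrite mulr_ge0 ?sqn_ge0.
have qp : 0 < q by rewrite lt_neqAle eq_sym qn0.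
by rewrite expr2 mulrA ler_pM2r// mulrC.
Qed.

End euclid.

(** * Ridge smoothers *)

Section ridge.
Context {R : realType} {n p s : nat}.
Variables (B : 'M[R]_(n, s)) (L : 'M[R]_(p, s)) (lam : R).
Hypothesis lam0 : 0 <= lam.
Let M := B^T *m B + lam *: (L^T *m L).
Hypothesis Mu : M \in unitmx.
Let D := B *m invmx M *m B^T.

Let dotM u v : dot u (M *m v) = dot (B *m u) (B *m v) + lam * dot (L *m u) (L *m v).
Proof.
by rewrite /M mulmxDl -scalemxAl dotDr dotZr -!mulmxA !dot_mulmxl.
Qed.

Let coef (z : 'cV[R]_n) : 'cV[R]_s := invmx M *m (B^T *m z).

Let BcoefE z : B *m coef z = D *m z.
Proof. by rewrite /coef /D !mulmxA. Qed.

Let McoefE z : M *m coef z = B^T *m z.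
Proof. by rewrite /coef mulKVmx. Qed.

(** [invmx M *m B^T *m z] minimises the penalised least squares criterion on the
    right: the gradient of that convex quadratic vanishes there. *)
Lemma ridge_residual_le (z : 'cV[R]_n) (b : 'cV[R]_s) :
  sqn (z - D *m z) <= sqn (z - B *m b) + lam * sqn (L *m b).
Proof.
set u := coef z.
have [g ->] : exists g, b = u + g by exists (b - u); rewrite addrC subrK.
have h : dot g (M *m u) = dot (B *m g) z by rewrite /u McoefE dot_mulmxl.
rewrite -BcoefE -/u !mulmxDr /sqn.
have h0 := sqn_ge0 (B *m g); have h1 := sqn_ge0 (L *m g).
have h2 := sqn_ge0 (L *m u).
rewrite dotM in h; rewrite /sqn in h0 h1 h2.
rewrite !dotE !(dotC (L *m u) (L *m g)) !(dotC z) !(dotC (B *m u) (B *m g)).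
have h3 := mulr_ge0 lam0 h1; have h4 := mulr_ge0 lam0 h2.
by rewrite mulrDr !mulrDr; lra.
Qed.

(** The coefficient [b] of [z] satisfies
    [<z, D z> = |B b|^2 + lam * |L b|^2 >= |D z|^2], which is combined with
    [|z - D z|^2 >= 0]. *)
Lemma ridge_contraction (z : 'cV[R]_n) : sqn (D *m z) <= sqn z.
Proof.
have h := dotM (coef z) (coef z).
rewrite McoefE -dot_mulmxl BcoefE in h.
have := sqn_ge0 (z - D *m z); have := mulr_ge0 lam0 (sqn_ge0 (L *m coef z)).
rewrite /sqn !dotE (dotC z) h; lra.
Qed.

End ridge.

(** * Bias of the sketched smoother *)

Lemma first_leP (R : realType) (u : nat -> R) (l : R) :
  (exists k, u k <= l) ->
  u (first_le u l) <= l /\ forall j, (j < first_le u l)%N -> l < u j.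
Proof.
move=> ex; rewrite /first_le; case: xgetP => [k -> //|nex].
case: (ex_minnP ex) => m um mmin; exfalso; apply: (nex m); split=> // j jm.
by rewrite ltNge; apply/negP => /mmin; rewrite leqNgt jm.
Qed.

Lemma spectral_first_le (R : realType) n (Kn U : 'M[R]_n) (m : nat -> R) (l : R) :
  0 <= l -> spectral_decomposition Kn U m ->
  [/\ (first_le m l <= n)%N,
      forall j, (j < first_le m l)%N -> l < m j &
      forall j, (first_le m l <= j)%N -> m j <= l].
Proof.
move=> l0 [_ _ mono _ z].
have [|h1 h2] := @first_leP _ m l; first by exists n; rewrite z.
split=> // [|j kj]; last exact: le_trans (mono _ _ kj) h1.
by rewrite leqNgt; apply/negP => /h2; rewrite z// ltNge l0.
Qed.

Section near_identity.
Context {R : realType} {k s : nat} (A : 'M[R]_(s, k)).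
Hypothesis hA : op_norm (A^T *m A - 1%:M) <= 2^-1.

(** [A^T *m A] is within 1/2 of the identity, hence coercive and invertible; for
    [w] the preimage of [h] by it, the vector [A *m w] is a solution whose squared
    norm is [<w, h>]. *)
Lemma near_isometry_solve (h : 'cV[R]_k) :
  exists2 b : 'cV[R]_s, A^T *m b = h & sqn b <= 2 * sqn h.
Proof.
set T := A^T *m A.
have hT v : sqn (T *m v - v) <= 4^-1 * sqn v.
  have -> : 4^-1 = 2^-1 ^+ 2 :> R by field.
  by have := op_norm_sqn v hA; rewrite mulmxBl mul1mx.
have low v : sqn v <= 2 * dot v (T *m v).
  have cs := dot_CauchySchwarz v (v - T *m v).
  have e : sqn (v - T *m v) = sqn (T *m v - v).
    by rewrite -opprB /sqn dotNl dotNr opprK.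
  have := hT v; rewrite -e => hTv.
  have v0 := sqn_ge0 v.
  have q : dot v (v - T *m v) <= 2^-1 * sqn v.
    have := le_trans cs (ler_wpM2l v0 hTv).
    by set x := dot v _; rewrite leNgt => cs'; apply/negP => x2; nra.
  by move: q; rewrite dotDr dotNr -/(sqn v); lra.
have Tu : T \in unitmx.
  rewrite -unitmx_tr -row_free_unit -kermx_eq0; apply/eqP/row_matrixP => i.
  rewrite row0; set r := row i _.
  have rT : r *m T^T = 0 by apply/eqP; rewrite -sub_kermx row_sub.
  have : sqn r^T <= 0.
    apply: le_trans (low _) _.
    by rewrite -[T]trmxK -trmx_mul rT trmx0 -(scale0r 0) dotZr mul0r mulr0.
  move=> r0; have /sqn_eq0 : sqn r^T = 0.
    by apply/eqP; rewrite eq_le r0 sqn_ge0.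
  by move=> /(congr1 trmx); rewrite trmxK trmx0.
set w := invmx T *m h.
have Tw : T *m w = h by rewrite /w mulKVmx.
have wh : sqn w <= 2 * dot w h by rewrite -Tw.
exists (A *m w); first by rewrite mulmxA.
rewrite /sqn dot_mulmxl mulmxA -/T Tw.
have := dot_CauchySchwarz w h; set x := dot w h in wh *.
have h0 := sqn_ge0 h => cs; rewrite -/(sqn h).
have cs' : x * x <= (2 * sqn h) * x.
  by rewrite -expr2; apply: le_trans cs _; nra.
have [x0|x0] := leP x 0; first by apply: le_trans x0 _; rewrite mulr_ge0.
by rewrite -(ler_pM2r x0).
Qed.

End near_identity.

Lemma diag_mulE (R : realType) k (F : 'I_k -> R) (v : 'cV[R]_k) j :
  (diag_mx (\row_i F i) *m v) j 0 = F j * v j 0.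
Proof. by rewrite mul_diag_mx !mxE. Qed.

Section sketch.
Context {R : realType} {n s : nat}.
Variables (c lam : R) (Kn : 'M[R]_n) (S : 'M[R]_(s, n)).

Let M := S *m (Kn *m Kn) *m S^T + lam *: (S *m Kn *m S^T).
Let D := Kn *m S^T *m invmx M *m S *m Kn.

(** The entries of [b] extended by 0 beyond [n], in the form in which they come
    out of [first_cols] and [last_cols]. *)
Let ext (b : 'cV[R]_n) (j : nat) : R := \sum_(i < n) b i 0 * (i == j :> nat)%:R.

Let extE b (i : 'I_n) : ext b i = b i 0.
Proof.
rewrite /ext (bigD1 i)//= eqxx mulr1 big1 ?addr0// => j ji.
by rewrite (_ : (j == i :> nat) = false) ?mulr0//; exact: negbTE.
Qed.

Let sum_ext (F : R -> nat -> R) (b : 'cV[R]_n) k : (k <= n)%N ->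
  \sum_(i < n) F (b i 0) i =
  \sum_(j < k) F (ext b j) j + \sum_(j < n - k) F (ext b (k + j)%N) (k + j)%N.
Proof.
move=> kn; under eq_bigr do rewrite -extE.
rewrite -(big_mkord xpredT (fun i => F (ext b i) i)) (big_cat_nat (n := k))//=.
rewrite big_mkord; congr (_ + _).
rewrite -{1}[k]add0n big_addn big_mkord.
by apply: eq_bigr => i _; rewrite addnC.
Qed.

Let trmx_cols (U : 'M[R]_n) k (P : 'M[R]_(n, k)) (g : nat -> nat) b (j : 'I_k) :
  (forall i j, P i j = (i == g j :> nat)%:R) ->
  ((S *m (U *m P))^T *m b) j 0 = ext ((S *m U)^T *m b) (g j).
Proof.
move=> hP; rewrite mulmxA trmx_mul -mulmxA mxE.
by apply: eq_bigr => i _; rewrite mxE hP mulrC.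
Qed.

(** By [ridge_residual_le] it is enough to exhibit one sketched combination [b]
    of the columns of [Kn] with a small penalised error.  In the eigenbasis of
    [Kn], it is chosen to reproduce the target exactly along the eigenvalues
    above [lam]; [near_isometry_solve] provides it, with a squared norm of order
    [sqn g / lam].  Along the eigenvalues below [lam] the target is itself of
    squared norm at most [lam * sqn g], and the second half of K-satisfiability
    damps what [b] contributes there.  The matrix [G] is a square root of [Kn]. *)
Lemma sketched_smoother_bias : 0 < lam -> K_satisfiable c lam Kn S ->
  M \in unitmx ->
  exists G : 'M[R]_n, [/\ Kn = G^T *m G,
    forall z, sqn (D *m z) <= sqn z &
    forall g, sqn (G^T *m g - D *m (G^T *m g)) <=
              3 * (1 + 2 * c ^+ 2) * lam * sqn g].
Proof.
move=> lam0 [U [m [spec [h1 h2]]]] Mu.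
have [kn mlow mhigh] := spectral_first_le (ltW lam0) spec.
move: kn mlow mhigh h1 h2; set k := first_le m lam => kn mlow mhigh h1 h2.
have [UU KE _ m0 _] := spec.
pose dm := diag_mx (\row_(i < n) m i).
pose dr := diag_mx (\row_(i < n) Num.sqrt (m i)).
have drr : dr *m dr = dm.
  rewrite /dr mulmx_diag /dm; congr diag_mx; apply/matrixP => i j.
  by rewrite !mxE -expr2 sqr_sqrtr.
pose G := dr *m U^T.
have GG : Kn = G^T *m G.
  by rewrite /G trmx_mul trmxK tr_diag_mx -!mulmxA (mulmxA dr) drr KE -mulmxA.
have KnT : Kn^T = Kn by rewrite GG trmx_mul trmxK.
have UtU : U^T *m U = 1%:M by rewrite mulmx1C.
have sqnU v : sqn (U *m v) = sqn v.
  by rewrite /sqn dot_mulmxl mulmxA UtU mul1mx.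
have MB : M = (Kn *m S^T)^T *m (Kn *m S^T) + lam *: ((G *m S^T)^T *m (G *m S^T)).
  have -> : (G *m S^T)^T *m (G *m S^T) = S *m Kn *m S^T.
    by rewrite GG trmx_mul trmxK !mulmxA.
  by rewrite trmx_mul trmxK KnT /M !mulmxA.
have DB : D = (Kn *m S^T) *m invmx M *m (Kn *m S^T)^T.
  by rewrite /D trmx_mul trmxK KnT !mulmxA.
exists G; split => // [z|g].
  by rewrite DB MB; apply: ridge_contraction; rewrite -?MB// ltW.
pose h : 'cV[R]_k := \col_j (ext g j / Num.sqrt (m j)).
have [b bh hb] := near_isometry_solve h1 h.
pose v := (S *m U)^T *m b.
have vlow (j : 'I_k) : ext v j = ext g j / Num.sqrt (m j).
  have /(congr1 (fun w : 'cV_k => w j 0)) := bh.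
  by rewrite /= [in RHS]mxE => <-; rewrite (@trmx_cols _ _ _ id)// => i j'; rewrite mxE.
have gsplit : sqn g = \sum_(j < k) ext g j ^+ 2 +
                \sum_(j < n - k) ext g (k + j)%N ^+ 2.
  by rewrite sqnE (sum_ext (fun x _ => x ^+ 2) _ kn).
have glow0 : 0 <= \sum_(j < k) ext g j ^+ 2.
  by apply: sumr_ge0 => j _; exact: sqr_ge0.
have ghigh0 : 0 <= \sum_(j < n - k) ext g (k + j)%N ^+ 2.
  by apply: sumr_ge0 => j _; exact: sqr_ge0.
have hh : lam * sqn h <= \sum_(j < k) ext g j ^+ 2.
  rewrite sqnE mulr_sumr; apply: ler_sum => j _.
  have mj := mlow j (ltn_ord j); have mj0 := lt_trans lam0 mj.
  rewrite mxE expr_div_n sqr_sqrtr ?(ltW mj0)// mulrCA -[leRHS]mulr1.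
  by rewrite ler_wpM2l ?sqr_ge0// ler_pdivrMr// mul1r ltW.
(* the part of the energy of [b] carried by the small eigenvalues *)
have vhigh : \sum_(j < n - k) m (k + j)%N * ext v (k + j)%N ^+ 2 <=
             2 * c ^+ 2 * sqn g.
  have lam0' := ltW lam0.
  have := sqn_trmx_le (sqr_ge0 _) (fun w => op_norm_sqn w h2) b.
  rewrite exprMn sqr_sqrtr// trmx_mul tr_diag_mx -mulmxA sqnE.
  under eq_bigr => j _.
    rewrite diag_mulE (@trmx_cols _ _ _ (addn k)).
      rewrite exprMn sqr_sqrtr//; over.
    by move=> i j'; rewrite mxE.
  have := mulr_ge0 (sqr_ge0 c) lam0'; have := sqr_ge0 c; nra.
have zE : G^T *m g = U *m (dr *m g).
  by rewrite /G trmx_mul trmxK tr_diag_mx mulmxA.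
have KbE : Kn *m S^T *m b = U *m (dm *m v).
  by rewrite KE /v trmx_mul !mulmxA.
have GbE : G *m S^T *m b = dr *m v.
  by rewrite /G /v trmx_mul !mulmxA.
rewrite DB MB; apply: le_trans.
  by apply: (@ridge_residual_le _ _ _ _ _ _ _ _ _ _ b); rewrite -?MB// ltW.
rewrite KbE zE GbE -mulmxBr sqnU.
have fit : sqn (dr *m g - dm *m v) <= 2 * lam *
    (\sum_(j < n - k) ext g (k + j)%N ^+ 2 +
     \sum_(j < n - k) m (k + j)%N * ext v (k + j)%N ^+ 2).
  have eE j : ext (dr *m g - dm *m v) j = Num.sqrt (m j) * ext g j - m j * ext v j.
    rewrite /ext !mulr_sumr -sumrB; apply: eq_bigr => i _.
    have -> : (dr *m g - dm *m v) i 0 = (dr *m g) i 0 - (dm *m v) i 0.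
      by rewrite [LHS]mxE; congr (_ + _); rewrite mxE.
    rewrite !diag_mulE.
    by case: eqP => [->|_]; rewrite ?(mulr1, mulr0, subrr).
  rewrite sqnE (sum_ext (fun x _ => x ^+ 2) _ kn) big1 ?add0r.
    rewrite -big_split mulr_sumr; apply: ler_sum => j _ /=.
    rewrite eE; set mj := m _; set x := ext g _; set y := ext v _.
    have mjl : mj <= lam by apply: mhigh; rewrite leq_addr.
    have mj0 : 0 <= mj by exact: m0.
    have e : Num.sqrt mj ^+ 2 = mj by rewrite sqr_sqrtr.
    have s1 := sqr_ge0 (Num.sqrt mj * x + mj * y).
    apply: (@le_trans _ _ (2 * mj * (x ^+ 2 + mj * y ^+ 2))).
      have -> : 2 * mj * (x ^+ 2 + mj * y ^+ 2) =
                2 * ((Num.sqrt mj * x) ^+ 2 + (mj * y) ^+ 2).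
        by rewrite !exprMn e; ring.
      move: s1; set p := _ * x; set q := mj * y; nra.
    have t0 : 0 <= x ^+ 2 + mj * y ^+ 2.
      by apply: addr_ge0; [exact: sqr_ge0|apply: mulr_ge0 => //; exact: sqr_ge0].
    by apply: ler_wpM2r => //; rewrite ler_pM2l.
  move=> j _; rewrite eE vlow.
  have sp : 0 < Num.sqrt (m j).
    by rewrite sqrtr_gt0 (lt_trans lam0)// mlow.
  rewrite -{2}(@sqr_sqrtr _ (m j))// (_ : _ - _ = 0) ?expr0n//.
  by field; rewrite gt_eqF.
have pen : sqn (dr *m v) = \sum_(j < k) ext g j ^+ 2 +
    \sum_(j < n - k) m (k + j)%N * ext v (k + j)%N ^+ 2.
  rewrite sqnE.
  under eq_bigr do rewrite diag_mulE exprMn sqr_sqrtr//.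
  rewrite (sum_ext (fun x i => m i * x ^+ 2) _ kn); congr (_ + _).
  apply: eq_bigr => j _; rewrite vlow expr_div_n sqr_sqrtr// mulrCA divff ?mulr1//.
  by rewrite gt_eqF// (lt_trans lam0)// mlow.
rewrite pen; apply: le_trans (lerD fit (lexx _)) _.
move: vhigh glow0 ghigh0; rewrite gsplit.
set x := \sum_(j < k) _; set y := \sum_(j < n - k) ext _ _ ^+ 2.
set w := \sum_(j < n - k) _ => vhigh x0 y0.
have e := mulr_ge0 (ltW lam0) x0; have e' := mulr_ge0 (ltW lam0) y0.
have := ler_wpM2l (ltW lam0) vhigh; have := sqr_ge0 c; nra.
Qed.

End sketch.

(** * Functions of bounded norm *)

Section rkhs.
Context {R : realType} {X : Type} {H : set (X -> R)}.
Context {ip : (X -> R) -> (X -> R) -> R} {K : X -> X -> R}.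
Hypothesis rkhs : is_rkhs H ip K.

Lemma rkhs_CauchySchwarz f g : H f -> H g -> ip f g ^+ 2 <= ip f f * ip g g.
Proof.
case: rkhs => -[H0 HD] [ipC ipD ip0 _] _ _ _ Hf Hg.
apply: discriminant_le => [|t]; first exact: ip0.
have Hh := HD t f g Hf Hg.
have := ip0 _ Hh; rewrite ipD// (ipC f)// (ipC g)// !ipD// (ipC g f)//.
by congr (_ <= _); ring.
Qed.

Lemma rkhs_combination n (a : 'I_n -> R) (x : 'I_n -> X) :
  H (fun t => \sum_(i < n) a i * K (x i) t) /\
  forall f, H f -> ip (fun t => \sum_(i < n) a i * K (x i) t) f =
                   \sum_(i < n) a i * f (x i).
Proof.
case: rkhs => -[H0 HD] [ipC ipD ip0 _] _ HK rep.
have ip0l f : H f -> ip (fun=> 0) f = 0.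
  move=> Hf; have := ipD (-1) (fun=> 0) (fun=> 0) f H0 H0 Hf.
  have -> : (fun x : X => -1 * 0 + 0 : R) = fun=> 0.
    by apply/funext => t; rewrite mulr0 addr0.
  by rewrite mulN1r addNr.
elim: n a x => [|n IH] a x.
  have -> : (fun t => \sum_(i < 0) a i * K (x i) t) = fun=> 0.
    by apply/funext => t; rewrite big_ord0.
  by split=> // f Hf; rewrite big_ord0 ip0l.
have [Hs ips] := IH (a \o lift ord0) (x \o lift ord0).
have -> : (fun t => \sum_(i < n.+1) a i * K (x i) t) = (fun t =>
    a ord0 * K (x ord0) t + \sum_(i < n) a (lift ord0 i) * K (x (lift ord0 i)) t).
  by apply/funext => t; rewrite big_ord_recl.
split=> [|f Hf]; first exact: HD.
by rewrite ipD// ips// big_ord_recl ipC// rep.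
Qed.

(** Point evaluations are inner products with kernel sections, so a linear
    combination of the values of [f] is controlled by its norm. *)
Lemma rkhs_eval_le n (a : 'I_n -> R) (x : 'I_n -> X) f : H f ->
  (\sum_(i < n) a i * f (x i)) ^+ 2 <=
  ip f f * \sum_(i < n) a i * \sum_(j < n) a j * K (x j) (x i).
Proof.
move=> Hf; have [Hg ipg] := rkhs_combination a x.
rewrite -ipg// mulrC -(ipg _ Hg); exact: rkhs_CauchySchwarz.
Qed.

End rkhs.

(** Duality: [|F - D F|^2] is the inner product of [F] with
    [a = (1 - D) (F - D F)], and the transpose of the bound on [(1 - D) G^T]
    controls [G a] by [F - D F] itself. *)
Lemma smoother_residual_le (R : realType) n (G D : 'M[R]_n) (F : 'cV[R]_n)
    (b k : R) : 0 <= b -> 0 <= k -> D^T = D ->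
  (forall g, sqn (G^T *m g - D *m (G^T *m g)) <= k * sqn g) ->
  (forall a, dot a F ^+ 2 <= b * sqn (G *m a)) ->
  sqn (F - D *m F) <= b * k.
Proof.
move=> b0 k0 DT hG hF; set r := F - D *m F; set q := sqn r.
have q0 : 0 <= q by exact: sqn_ge0.
have hGT w : sqn (G *m (w - D *m w)) <= k * sqn w.
  have h g : sqn ((G^T - D *m G^T) *m g) <= k * sqn g.
    by rewrite mulmxBl -mulmxA.
  have := sqn_trmx_le k0 h w.
  by rewrite linearB /= trmx_mul trmxK DT mulmxBl mulmxBr mulmxA.
have qE : q = dot (r - D *m r) F.
  rewrite dotC -{1}DT dotDr dotNr -dot_mulmxl -dotNl -dotDl.
  by rewrite /q.
have : q ^+ 2 <= b * k * q.
  rewrite {1}qE; apply: le_trans (hF _) _; rewrite -mulrA.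
  by apply: ler_wpM2l.
have [->|qn0] := eqVneq q 0; first by rewrite mulr_ge0.
have qp : 0 < q by rewrite lt_neqAle eq_sym qn0.
by rewrite expr2 ler_pM2r.
Qed.

Section statistic.
Context {R : realType} {X : Type}.
Variables (K : X -> X -> R) (n s : nat) (lam : R) (x : 'I_n -> X).
Variable S : 'M[R]_(s, n).

Let Kn := kernel_mx K x.
Let D := Delta K lam x S.

Lemma emp_normE (g : X -> R) :
  emp_norm x g ^+ 2 = n%:R^-1 * sqn (\col_i g (x i)).
Proof.
rewrite /emp_norm sqr_sqrtr ?mulr_ge0 ?invr_ge0 ?ler0n ?sumr_ge0//.
  by rewrite sqnE; congr (_ * _); apply: eq_bigr => i _; rewrite mxE.
by move=> i _; exact: sqr_ge0.
Qed.

Lemma T_statE (y : 'cV[R]_n) : (0 < n)%N ->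
  T_stat K lam x S y = n%:R^-1 * sqn (D *m y).
Proof.
move=> n0; rewrite /T_stat emp_normE; congr (_ * sqn _).
apply/matrixP => j j'; rewrite ord1 mxE /f_hat.
rewrite /D /Delta -2!mulmxA -(mulmxA (Kn *m _)) -(mulmxA Kn) mxE.
apply: eq_bigr => i _; rewrite [Kn _ _]mxE /beta_hat.
rewrite -scalemxAr mxE mulrC -mulrA mulrCA -!mulmxA.
by rewrite mulrCA mulrA.
Qed.

Lemma trmx_Delta : Kn^T = Kn -> D^T = D.
Proof.
move=> KT; rewrite /D /Delta !trmx_mul trmxK -/Kn KT trmx_inv.
have -> : (sketched_mx K lam x S)^T = sketched_mx K lam x S.
  by rewrite /sketched_mx linearD linearZ /= !trmx_mul trmxK -/Kn KT !mulmxA.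
by rewrite !mulmxA.
Qed.

(** The reproducing property turns the bound on the norm of [f] into the
    hypothesis of [smoother_residual_le]; the factor [n] there comes from the
    normalisation of the kernel matrix. *)
Lemma Delta_signal (H : set (X -> R)) ip (c C : R) f :
  is_rkhs H ip K -> (0 < n)%N -> 0 < lam -> 0 <= C ->
  K_satisfiable c lam Kn S -> sketched_mx K lam x S \in unitmx ->
  H f -> hnorm ip f <= C ->
  [/\ Kn^T = Kn, forall z, sqn (D *m z) <= sqn z &
  n%:R^-1 * sqn (\col_i f (x i) - D *m \col_i f (x i)) <=
    C ^+ 2 * (3 * (1 + 2 * c ^+ 2) * lam)].
Proof.
move=> rkhs n0 lam0 C0 sat unit Hf fC.
have [G [KG Dle hG]] := sketched_smoother_bias lam0 sat unit.
have KT : Kn^T = Kn by rewrite KG trmx_mul trmxK.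
have np : 0 < n%:R :> R by rewrite ltr0n.
split=> //; rewrite ler_pdivrMl// (mulrA n%:R) (mulrC n%:R).
apply: (smoother_residual_le (G := G)) => // [| | |a].
- by rewrite mulr_ge0 ?sqr_ge0// ltW.
- by have c2 := sqr_ge0 c; apply: mulr_ge0; [apply: mulr_ge0 => //; lra|exact: ltW].
- exact: trmx_Delta.
have ipf : ip f f <= C ^+ 2.
  case: rkhs => _ [_ _ ip0 _] _ _ _.
  rewrite -(sqr_sqrtr (ip0 _ Hf)); apply: lerXn2r fC => //.
  by rewrite nnegrE sqrtr_ge0.
have -> : dot a (\col_i f (x i)) = \sum_(i < n) a i 0 * f (x i).
  by apply: eq_bigr => i _; rewrite mxE.
have := rkhs_eval_le rkhs (fun i => a i 0) x Hf.
set Q := (X in _ <= _ * X) => hQ.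
have QE : Q = n%:R * sqn (G *m a).
  rewrite /sqn dot_mulmxl mulmxA -KG /Q /dot mulr_sumr.
  apply: eq_bigr => i _; rewrite mxE mulrCA; congr (_ * _).
  rewrite mulr_sumr; apply: eq_bigr => j _.
  have -> : Kn i j = n%:R^-1 * K (x j) (x i) by rewrite -[Kn]KT !mxE.
  by rewrite mulrA (mulrA n%:R) divff ?gt_eqF// mul1r mulrC.
by rewrite -mulrA; apply: le_trans hQ _; rewrite QE; apply: ler_wpM2r => //;
  rewrite mulr_ge0 ?sqn_ge0// ltW.
Qed.

End statistic.

(** * Moments of the standard normal law *)

Section gauss.
Context {R : realType}.
Notation lmu := (@lebesgue_measure R).
Notation N := (@normal_prob R 0 1).

(** The density agrees almost everywhere with the Radon-Nikodym derivative of
    the normal law, for which the change of variables holds. *)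
Lemma ge0_integral_normal (f : R -> R) : (forall x, 0 <= f x) ->
  measurable_fun setT f ->
  (\int[N]_x (f x)%:E = \int[lmu]_x (f x * normal_pdf 0 1 x)%:E)%E.
Proof.
move=> f0 mf.
have dom := normal_prob_dominates (0 : R) 1.
have mf' : measurable_fun setT (EFin \o f) by apply/measurable_EFinP.
rewrite -(Radon_Nikodym_SigmaFinite.change_of_variables dom (f := EFin \o f))//.
have mpdf := measurable_normal_pdf (0 : R) 1.
have mpdf' : measurable_fun setT (EFin \o normal_pdf (0 : R) 1).
  exact/measurable_EFinP.
have fint := Radon_Nikodym_SigmaFinite.f_integrable dom.
under [RHS]eq_integral do rewrite EFinM.
apply: ae_eq_integral => //.
- by apply: emeasurable_funM => //; exact: measurable_int fint.
- exact: emeasurable_funM.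
apply: ae_eqe_mul2l; apply: integral_ae_eq => // E _ mE.
by rewrite -Radon_Nikodym_SigmaFinite.f_integral.
Qed.

Lemma normal_pdf_scaled (s x : R) : 0 < s ->
  s * normal_pdf 0 s x = normal_pdf 0 1 x * expR (x ^+ 2 / 2 * (1 - s ^- 2)).
Proof.
move=> s0; rewrite !normal_pdfE ?gt_eqF// /normal_fun /normal_peak !subr0.
rewrite -[RHS]mulrA -expRD mulrA; congr (_ * expR _); last first.
  by field; rewrite gt_eqF.
rewrite -!mulrnAr expr1n mul1r sqrtrM ?sqr_ge0// sqrtr_sqr ger0_norm ?ltW//.
by rewrite invfM mulrA divff ?mul1r// gt_eqF.
Qed.


Let mpdf (s : R) : measurable_fun setT (fun x => (normal_pdf 0 s x)%:E).
Proof. by apply/measurable_EFinP; exact: measurable_normal_pdf. Qed.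

Let msqr : measurable_fun setT (fun x : R => x ^+ 2 * normal_pdf 0 1 x).
Proof.
apply: measurable_funM; last exact: measurable_normal_pdf.
exact: measurable_funX.
Qed.

Let pdf_sqr_ge0 (x : R) : 0 <= x ^+ 2 * normal_pdf 0 1 x.
Proof. apply: mulr_ge0; [exact: sqr_ge0|exact: normal_pdf_ge0]. Qed.

(** The densities of all variances have integral 1, and [expR t >= 1 + t]
    bounds the density of variance [s ^+ 2] below by a combination of the
    standard one and of the integrand of the second moment. *)
Lemma normal_pdf_comparison (s x : R) : 0 < s ->
  normal_pdf 0 1 x <=
  s * normal_pdf 0 s x + (s ^- 2 - 1) / 2 * (x ^+ 2 * normal_pdf 0 1 x).
Proof.
move=> s0; rewrite normal_pdf_scaled//.
have := expR_ge1Dx (x ^+ 2 / 2 * (1 - s ^- 2)).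
move=> /(ler_wpM2l (normal_pdf_ge0 0 1 x)).
by set p := normal_pdf _ _ _; set e := expR _; set t := s ^- 2; lra.
Qed.

Let int_sqr (k : R) : 0 <= k ->
  (\int[lmu]_x (k * (x ^+ 2 * normal_pdf 0 1 x))%:E =
   k%:E * \int[N]_x (x ^+ 2)%:E)%E.
Proof.
move=> k0; rewrite ge0_integral_normal; last 2 first.
- by move=> x; exact: sqr_ge0.
- exact: measurable_funX.
under eq_integral do rewrite EFinM.
rewrite ge0_integralZl_EFin//; last exact/measurable_EFinP.
by move=> x _; rewrite lee_fin.
Qed.

Let int_comb (s c k : R) : 0 <= c -> 0 <= k ->
  (\int[lmu]_x (c * normal_pdf 0 s x + k * (x ^+ 2 * normal_pdf 0 1 x))%:E =
   c%:E + k%:E * \int[N]_x (x ^+ 2)%:E)%E.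
Proof.
move=> c0 k0; rewrite -(int_sqr k0).
have -> : c%:E = (\int[lmu]_x (c * normal_pdf 0 s x)%:E)%E.
  under eq_integral do rewrite EFinM.
  rewrite ge0_integralZl_EFin//; first by rewrite integral_normal_pdf mule1.
  - by move=> x _; rewrite lee_fin normal_pdf_ge0.
  - exact: mpdf.
rewrite -ge0_integralD//.
- by move=> x _; rewrite lee_fin mulr_ge0 ?normal_pdf_ge0.
- by apply/measurable_EFinP/measurable_funM => //; exact: measurable_normal_pdf.
- by move=> x _; rewrite lee_fin mulr_ge0.
- by apply/measurable_EFinP/measurable_funM.
Qed.

Let m_comb (s c k : R) : measurable_fun setT
  (fun x => (c * normal_pdf 0 s x + k * (x ^+ 2 * normal_pdf 0 1 x))%:E).
Proof.
apply/measurable_EFinP/measurable_funD; apply: measurable_funM => //.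
exact: measurable_normal_pdf.
Qed.

Let comb_ge0 (s c k x : R) : 0 <= c -> 0 <= k ->
  (0 <= (c * normal_pdf 0 s x + k * (x ^+ 2 * normal_pdf 0 1 x))%:E)%E.
Proof.
by move=> c0 k0; rewrite lee_fin addr_ge0// mulr_ge0// normal_pdf_ge0.
Qed.

Let second_moment_lt1 (s : R) : 0 < s -> s < 1 ->
  (1 <= s%:E + ((s ^- 2 - 1) / 2)%:E * \int[N]_x (x ^+ 2)%:E)%E.
Proof.
move=> s0 s1.
have k0 : 0 <= (s ^- 2 - 1) / 2.
  by rewrite divr_ge0// subr_ge0 invf_ge1 ?exprn_gt0// expr_le1 ?ltW.
rewrite -(int_comb s (ltW s0) k0) -(@integral_normal_pdf R 0 1).
apply: ge0_le_integral => //.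
- by move=> x _; rewrite lee_fin normal_pdf_ge0.
- exact: mpdf.
- exact: m_comb.
- by move=> x _; rewrite lee_fin normal_pdf_comparison.
Qed.

Let second_moment_gt1 (s : R) : 1 < s ->
  (1 + ((1 - s ^- 2) / 2)%:E * \int[N]_x (x ^+ 2)%:E <= s%:E)%E.
Proof.
move=> s1; have s0 : 0 < s by exact: lt_trans s1.
have k0 : 0 <= (1 - s ^- 2) / 2.
  by rewrite divr_ge0// subr_ge0 invf_le1 ?exprn_gt0// exprn_ege1// ltW.
rewrite -(int_comb 1 ler01 k0).
have -> : s%:E = (\int[lmu]_x
    (s * normal_pdf 0 s x + 0 * (x ^+ 2 * normal_pdf 0 1 x))%:E)%E.
  by rewrite (int_comb s (ltW s0) (lexx 0)) mul0e adde0.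
apply: ge0_le_integral => //.
- by move=> x _; exact: comb_ge0.
- exact: m_comb.
- exact: m_comb.
- move=> x _; rewrite lee_fin mul0r addr0 mul1r.
  by have := normal_pdf_comparison x s0; lra.
Qed.

(** Integrated for [s < 1] and for [s > 1], the comparison [normal_pdf_comparison]
    bounds the second moment [m] on both sides: [(1 + s) * m] is at least, resp.
    at most, [2 * s ^+ 2].  Then [s] tends to 1. *)
Lemma normal_second_moment : (\int[N]_x (x ^+ 2)%:E = 1)%E.
Proof.
have m0 : (0 <= \int[N]_x (x ^+ 2)%:E)%E.
  by apply: integral_ge0 => x _; rewrite lee_fin sqr_ge0.
have lt1 := second_moment_lt1; have gt1 := second_moment_gt1.
move: m0 lt1 gt1; case: (\int[N]_x _)%E => [r|_ _|//]; last first.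
  move=> /(_ 2 (ltr1n _ 2)).
  have k0 : 0 < (1 - 2 ^- 2) / 2 :> R by lra.
  by rewrite gt0_muley ?lte_fin// addey// leye_eq.
rewrite lee_fin => r0 lt1 gt1; congr (_%:E).
have {}lt1 s : 0 < s -> s < 1 -> 2 * s ^+ 2 * (1 - s) <= (1 - s ^+ 2) * r.
  move=> s0 s1; have := lt1 s s0 s1; rewrite -EFinM -EFinD lee_fin.
  have s2 : 0 < s ^+ 2 by rewrite exprn_gt0.
  have e : s ^- 2 * s ^+ 2 = 1 by rewrite mulVf// gt_eqF.
  move: e; set t := s ^- 2; set q := s ^+ 2 in s2 * => e h; nra.
have {}gt1 s : 1 < s -> (s ^+ 2 - 1) * r <= 2 * s ^+ 2 * (s - 1).
  move=> s1; have := gt1 s s1; rewrite -EFinM -EFinD lee_fin.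
  have s2 : 0 < s ^+ 2 by rewrite exprn_gt0// (lt_trans _ s1).
  have e : s ^- 2 * s ^+ 2 = 1 by rewrite mulVf// gt_eqF.
  move: e; set t := s ^- 2; set q := s ^+ 2 in s2 * => e h; nra.
(* with [s = 1 + t], resp. [s = 1 - t], a small [t] contradicts [r != 1] *)
apply/eqP; rewrite eq_le; apply/andP; split; rewrite leNgt; apply/negP => hr.
- pose t := Num.min 1 ((r - 1) / 5).
  have t0 : 0 < t by rewrite lt_min ltr01 divr_gt0// subr_gt0.
  have t1 : t <= 1 by rewrite ge_min lexx.
  have t5 : t <= (r - 1) / 5 by rewrite ge_min lexx orbT.
  have : (2 + t) * r <= 2 * (1 + t) ^+ 2.
    by rewrite -(ler_pM2l t0); have := gt1 (1 + t); rewrite ltrDl; nra.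
  nra.
- pose t := (1 - r) / 4.
  have t0 : 0 < t by rewrite divr_gt0// subr_gt0.
  have t1 : t < 1 by rewrite /t; lra.
  have : 2 * (1 - t) ^+ 2 <= (2 - t) * r.
    rewrite -(ler_pM2l t0); have := lt1 (1 - t).
    by rewrite subr_gt0 t1 ltrBlDr ltrDl t0 => /(_ isT isT); nra.
  have : r = 1 - 4 * t by rewrite /t; lra.
  move=> -> ; nra.
Qed.

(** As [x ^+ 4 <= 64 * expR (x ^+ 2 / 4)], the integrand is at most a multiple of
    the normal density of variance 2. *)
Lemma normal_fourth_moment : (\int[N]_x (x ^+ 4)%:E < +oo)%E.
Proof.
have m4 : measurable_fun setT (fun x : R => x ^+ 4) by exact: measurable_funX.
have s20 : 0 < Num.sqrt 2 :> R by rewrite sqrtr_gt0.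
rewrite ge0_integral_normal//; last by move=> x; rewrite exprn_even_ge0.
apply: (@le_lt_trans _ _
    (\int[lmu]_x (64 * Num.sqrt 2 * normal_pdf 0 (Num.sqrt 2) x +
                   0 * (x ^+ 2 * normal_pdf 0 1 x))%:E)%E).
  apply: ge0_le_integral => //.
  - by move=> x _; rewrite lee_fin mulr_ge0 ?normal_pdf_ge0// exprn_even_ge0.
  - by apply/measurable_EFinP/measurable_funM => //; exact: measurable_normal_pdf.
  - exact: m_comb.
  - move=> x _; rewrite lee_fin mul0r addr0 -mulrA normal_pdf_scaled// sqr_sqrtr//.
    rewrite mulrCA (mulrC (x ^+ 4)); apply: ler_wpM2l; first exact: normal_pdf_ge0.
    have -> : x ^+ 2 / 2 * (1 - 2^-1) = x ^+ 2 / 8 + x ^+ 2 / 8 by field.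
    have := expR_ge1Dx (x ^+ 2 / 8); rewrite expRD.
    have := sqr_ge0 x; rewrite -[x ^+ 4]/(x ^+ (2 * 2)) exprM.
    by set y := x ^+ 2; set e := expR _ => y0 h; nra.
by rewrite int_comb ?mul0e ?adde0 ?ltry// mulr_ge0// ltW.
Qed.

Lemma normal_prob_ray_oppr (a : R) :
  N [set x | a <= x] = N [set x | x <= - a].
Proof.
rewrite /normal_prob -set_itvcy -set_itvNyc ge0_integration_by_substitutionNy.
- apply: eq_integral => x _ /=; congr (_%:E).
  by rewrite !normal_pdfE ?oner_neq0// /normal_fun !subr0 sqrrN.
- by apply: continuous_subspaceT; exact: continuous_normal_pdf (oner_neq0 _).
- by move=> x _; exact: normal_pdf_ge0.
Qed.

End gauss.

Definition mfun_of d d' (T : measurableType d) (T' : measurableType d')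
    (f : T -> T') (mf : measurable_fun setT f) : {mfun T >-> T'} :=
  HB.pack f (isMeasurableFun.Build _ _ _ _ f mf).

Lemma measurable_idR (R : realType) :
  measurable_fun setT (id : measurableTypeR R -> R).
Proof. by move=> _ A mA; rewrite setTI. Qed.

(** The normal law transported to [R] with its default measurable structure:
    [normal_prob] is a measure on [measurableTypeR R], which has the same
    measurable sets but another display. *)
Definition std_normal (R : realType) : probability R R :=
  distribution (normal_prob 0 1) (mfun_of (@measurable_idR R)).

Lemma std_normal_second_moment (R : realType) :
  (\int[std_normal R]_x (x ^+ 2)%:E = 1)%E.
Proof.
rewrite ge0_integral_distribution; first exact: normal_second_moment.
- by apply/measurable_EFinP; exact: measurable_funX.
- by move=> x; rewrite lee_fin sqr_ge0.
Qed.

Lemma std_normal_fourth_moment (R : realType) :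
  (\int[std_normal R]_x (x ^+ 4)%:E < +oo)%E.
Proof.
rewrite ge0_integral_distribution; first exact: normal_fourth_moment.
- by apply/measurable_EFinP; exact: measurable_funX.
- by move=> x; rewrite lee_fin exprn_even_ge0.
Qed.

(** * Measures on tuples *)

Section boxes.
Context {R : realType} {n : nat}.

Definition ray (o : option rat) : set R :=
  if o is Some r then [set x | x <= ratr r] else setT.

(** Rational end points, and [None] for an unconstrained coordinate, make the
    boxes a countable pi-system that contains the whole space. *)
Definition box (q : {ffun 'I_n -> option rat}) : set (n.-tuple R) :=
  [set t | forall i, ray (q i) (tnth t i)].

Lemma measurable_ray o : measurable (ray o).
Proof.
case: o => [r|]; last exact: measurableT.
rewrite (_ : ray _ = `]-oo, ratr r]%classic).
  exact: measurable_itv.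
by rewrite set_itvNyc.
Qed.

Lemma measurable_rect (A : 'I_n -> set R) : (forall i, measurable (A i)) ->
  measurable [set t : n.-tuple R | forall i, A i (tnth t i)].
Proof.
move=> mA.
have -> : [set t : n.-tuple R | forall i, A i (tnth t i)] =
    \bigcap_(i in [set: 'I_n]) ((@tnth n R ^~ i) @^-1` A i).
  by apply/seteqP; split => t /= h i; [move=> _; exact: h|exact: h].
apply: fin_bigcap_measurable => [|i _]; first exact: finite_finset.
by rewrite -[_ @^-1` _]setTI; exact: measurable_tnth.
Qed.

Lemma setI_box : setI_closed (range box).
Proof.
pose omin (a b : option rat) := match a, b with
  | Some x, Some y => Some (Num.min x y) | Some x, None => Some x
  | None, o => o end.
move=> _ _ [p _ <-] [q _ <-]; exists [ffun i => omin (p i) (q i)] => //.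
have rayI a b : ray (omin a b) = ray a `&` ray b.
  case: a b => [a|] [b|] /=; rewrite ?setIT ?setTI//.
  apply/seteqP; split => x /=.
    by rewrite minElt; case: ltP => ab xm; split => //; apply: le_trans xm _;
      rewrite ler_rat// ltW.
  by rewrite minElt; case: ltP => ab [].
apply/seteqP; split => [t h|t [h1 h2] i].
  by split=> i; have := h i; rewrite ffunE rayI => -[].
by rewrite ffunE rayI; split.
Qed.

Lemma measurable_boxE : @measurable _ (n.-tuple R) = <<s range box >>.
Proof.
apply/seteqP; split; last first.
  apply: smallest_sub; first exact: sigma_algebra_measurable.
  by move=> _ [q _ <-]; apply: (@measurable_rect (fun i => ray (q i))) => i;
    exact: measurable_ray.
have mt (i : 'I_n) : measurable_fun setT
    ((fun t => tnth t i) : g_sigma_algebraType (range box) -> R).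
  apply: (measurability _ (RGenOInfty.measurableE R)) => //.
  move=> _ [_ [r ->] <-]; rewrite setTI.
  have -> : (fun t : g_sigma_algebraType (range box) => tnth t i) @^-1` `]r, +oo[ =
     \bigcup_(q : rat) (if r <= ratr q then
       ~` box [ffun j => if j == i then Some q else None] else set0).
    apply/seteqP; split => [t /=|t [q _]].
      rewrite in_itv/= andbT => /rat_in_itvoo[q].
      rewrite in_itv/= => /andP[rq qt]; exists q => //.
      rewrite (ltW rq) => /(_ i); rewrite ffunE eqxx /=.
      by rewrite leNgt qt.
    case: ifP => [rq /= nb|//]; rewrite in_itv/= andbT ltNge; apply/negP => tr.
    apply: nb => j; rewrite ffunE; case: eqP => [->|//] /=.
    exact: le_trans tr rq.
  apply: bigcupT_measurable_rat => q; case: ifP => _; last exact: measurable0.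
  apply: measurableC; apply: sub_sigma_algebra.
  by exists [ffun j => if j == i then Some q else None].
have : measurable_fun setT
    (id : g_sigma_algebraType (range box) -> n.-tuple R).
  by apply/measurable_fun_tnthP => i; exact: mt.
by move=> h A mA; have := h measurableT A mA; rewrite setTI.
Qed.

(** The boxes are a pi-system generating the Borel sets.  Their countability is
    what later lets an almost sure identity hold for all of them at once. *)
Lemma measure_box_unique (m1 m2 : {measure set (n.-tuple R) -> \bar R}) :
  (m1 setT < +oo)%E -> (forall q, m1 (box q) = m2 (box q)) ->
  forall A, measurable A -> m1 A = m2 A.
Proof.
move=> fin m12 A mA.
have boxT : box [ffun=> None] = setT.
  by apply/seteqP; split => // t _ i; rewrite ffunE.
apply: (measure_unique (range box) (fun=> setT)) => //.
- exact: measurable_boxE.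
- exact: setI_box.
- by move=> _; exists [ffun=> None].
- by rewrite bigcup_const.
- by move=> _ [q _ <-].
Qed.

End boxes.

(** * Quadratic forms of a standard normal vector *)

Section normal_vector.
Context {R : realType} {n : nat}.
Notation N := (std_normal R).

Definition std_normal_vector (nu : set (n.-tuple R) -> \bar R) : Prop :=
  forall A : 'I_n -> set R, (forall i, measurable (A i)) ->
  nu [set t | forall i, A i (tnth t i)] = (\prod_(i < n) N (A i))%E.

Variable nu : probability (n.-tuple R) R.
Hypothesis std : std_normal_vector nu.

Let marginal (B : 'I_n -> set R) (D : {set 'I_n}) :
  (forall i, measurable (B i)) ->
  nu [set t | forall i, i \in D -> B i (tnth t i)] = (\prod_(i in D) N (B i))%E.
Proof.
move=> mB.
have := @std (fun i => if i \in D then B i else setT).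
rewrite (_ : [set t | _] = [set t | forall i, i \in D -> B i (tnth t i)]).
  move=> ->; last by move=> i; case: ifP.
  rewrite (bigID (mem D))/= [X in (_ * X)%E]big1 ?mule1.
    by apply: eq_bigr => i ->.
  by move=> i /negbTE ->; exact: probability_setT.
by apply/seteqP; split => t /= h i; have := h i; case: ifP => // _; apply.
Qed.

Lemma ge0_expectation1 (i : 'I_n) (f : R -> R) : (forall x, 0 <= f x) ->
  measurable_fun setT f ->
  (\int[nu]_t (f (tnth t i))%:E = \int[N]_x (f x)%:E)%E.
Proof.
move=> f0 mf.
rewrite -(@ge0_integral_distribution _ _ _ _ _ nu (mfun_of (measurable_tnth i))
  (fun x => (f x)%:E))//; last exact/measurable_EFinP.
apply: (eq_measure_integral N) => B mB _.
have := @marginal (fun=> B) [set i] (fun=> mB).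
rewrite big_set1 => h; refine (etrans _ h); congr (nu _).
by apply/seteqP; split => t /=; [move=> Bt j; rewrite inE => /eqP ->
  |apply; rewrite inE].
Qed.

(** Two distinct coordinates have the product law, so Tonelli's theorem
    applies. *)
Lemma ge0_expectation2 (i j : 'I_n) (f g : R -> R) : i != j ->
  (forall x, 0 <= f x) -> (forall x, 0 <= g x) ->
  measurable_fun setT f -> measurable_fun setT g ->
  (\int[nu]_t (f (tnth t i) * g (tnth t j))%:E =
   \int[N]_x (f x)%:E * \int[N]_x (g x)%:E)%E.
Proof.
move=> ij f0 g0 mf mg.
pose phi (t : n.-tuple R) := (tnth t i, tnth t j).
have mphi : measurable_fun setT phi.
  by apply: measurable_fun_pair; exact: measurable_tnth.
pose F (z : R * R) := (f z.1 * g z.2)%:E.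
have F0 z : (0 <= F z)%E by rewrite lee_fin mulr_ge0.
have mF : measurable_fun setT F.
  by apply/measurable_EFinP; apply: measurable_funM; exact: measurableT_comp.
rewrite -[LHS]/(\int[nu]_t (F \o mfun_of mphi) t)%E -ge0_integral_distribution//.
transitivity (\int[N \x N]_z F z)%E.
  apply: (eq_measure_integral (N \x N)%E) => B mB _; apply/esym.
  apply: (@product_measure_unique _ _ _ _ _ N N) => // C D mC mD.
  have := @marginal (fun k => if k == i then C else D) [set i; j].
  rewrite (big_setD1 i) ?set21//= eqxx (_ : [set i; j] :\ i = [set j])%SET.
    rewrite big_set1 eq_sym (negbTE ij) => h.
    refine (etrans _ (h _)); last by move=> k; case: ifP.
    congr (nu _); apply/seteqP; split => t /=.
      by move=> [Ct Dt] k; rewrite !inE => /orP[] /eqP ->;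
        rewrite ?eqxx// eq_sym (negbTE ij).
    move=> ht; split; first by have := ht i; rewrite set21 eqxx; apply.
    by have := ht j; rewrite set22 eq_sym (negbTE ij); apply.
  by apply/setP => k; rewrite !inE; case: eqVneq => //= ->; rewrite (negbTE ij).
rewrite fubini_tonelli1// /fubini_F.
under eq_integral.
  move=> x _; rewrite /F /=.
  under eq_integral do rewrite EFinM.
  rewrite ge0_integralZl_EFin//; [|by move=> y _; rewrite lee_fin
    |exact/measurable_EFinP].
  over.
have g0' : (0 <= \int[N]_x (g x)%:E)%E.
  by apply: integral_ge0 => x _; rewrite lee_fin.
rewrite ge0_integralZr//; first exact/measurable_EFinP.
by move=> x _; rewrite lee_fin.
Qed.

Let flip (j : 'I_n) (t : n.-tuple R) : n.-tuple R :=
  [tuple if i == j then - tnth t i else tnth t i | i < n].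

Let tnth_flip j t i :
  tnth (flip j t) i = if i == j then - tnth t i else tnth t i.
Proof. by rewrite tnth_mktuple. Qed.

Let measurable_flip j : measurable_fun setT (flip j).
Proof.
apply/measurable_fun_tnthP => i.
rewrite (_ : _ \o _ = fun t => if i == j then - tnth t i else tnth t i).
  case: eqP => _; last exact: measurable_tnth.
  by apply: measurableT_comp => //; exact: measurable_tnth.
by apply/funext => t /=; rewrite tnth_flip.
Qed.

Let measure_flip j : forall A, measurable A -> nu (flip j @^-1` A) = nu A.
Proof.
pose m2 : {measure set (n.-tuple R) -> \bar R} :=
  distribution nu (mfun_of (@measurable_flip j)).
move=> A mA; apply/esym.
apply: (@measure_box_unique _ _ nu m2 _ _ A mA).
  by apply: le_lt_trans (probability_le1 nu measurableT) _; exact: ltry.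
move=> q; rewrite /m2 /= /pushforward.
pose A' i := if i == j then [set x | ray (q i) (- x)] else @ray R (q i).
have mA' i : measurable (A' i).
  rewrite /A'; case: eqP => _; last exact: measurable_ray.
  rewrite -[X in measurable X]setTI.
  have mo : measurable_fun setT (-%R : R -> R) by [].
  by apply: mo => //; exact: measurable_ray.
transitivity (nu [set t | forall i, A' i (tnth t i)]); last first.
  congr (nu _); apply/seteqP; split => t /= h i; have := h i;
    by rewrite tnth_flip /A'; case: eqP.
rewrite (std mA') (@std (fun i => ray (q i))); last by move=> i; exact: measurable_ray.
apply: eq_bigr => i _; rewrite /A'; case: eqP => // _.
case: (q i) => [r|//] /=.
have h := normal_prob_ray_oppr (- ratr r : R); rewrite opprK in h.
refine (esym (etrans (congr1 (normal_prob 0 1) _) h)).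
by apply/seteqP; split => x /=; rewrite lerNl.
Qed.

(** Changing the sign of one coordinate preserves the law, so it kills the
    expectation of every function that is odd in that coordinate. *)
Let expectation_odd j (F : n.-tuple R -> R) :
  nu.-integrable setT (EFin \o F) -> (forall t, F (flip j t) = - F t) ->
  (\int[nu]_t (F t)%:E = 0)%E.
Proof.
move=> intF oddF.
have mF := measurable_int _ intF.
have e : (\int[nu]_t (F t)%:E = - \int[nu]_t (F t)%:E)%E.
  have intN : nu.-integrable setT (EFin \o (\- F)).
    have -> : EFin \o (\- F) = (fun t => - (EFin \o F) t)%E by [].
    exact: integrableN.
  rewrite -[RHS]integralN//; last exact/integrable_add_def.
  transitivity (\int[distribution nu (mfun_of (@measurable_flip j))]_t (F t)%:E)%E.
    by apply: (eq_measure_integral (distribution nu (mfun_of (@measurable_flip j))));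
      move=> A mA _; apply/esym; exact: measure_flip.
  rewrite integral_distribution//.
    by apply: eq_integral => t _ /=; rewrite oddF.
  by apply: eq_integrable intN => // t _ /=; rewrite oddF.
have := integrable_fin_num measurableT intF.
move: e; case: (\int[nu]_t _)%E => //= r [] e _; congr (_%:E); lra.
Qed.

Let x4 (i : 'I_n) (t : n.-tuple R) : R := tnth t i ^+ 4.

Let measurable_coord (i : 'I_n) : measurable_fun setT (fun t : n.-tuple R => tnth t i).
Proof. exact: measurable_tnth. Qed.

Definition kurtosis : R := fine (\int[N]_x (x ^+ 4)%:E)%E.

Let measurable_pow4 : measurable_fun setT (fun x : R => x ^+ 4).
Proof. exact: measurable_funX. Qed.

Let kurtosisE : (\int[N]_x (x ^+ 4)%:E = kurtosis%:E)%E.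
Proof.
rewrite /kurtosis fineK// ge0_fin_numE ?std_normal_fourth_moment//.
by apply: integral_ge0 => x _; rewrite lee_fin exprn_even_ge0.
Qed.

Let expectation_x4 i : (\int[nu]_t (x4 i t)%:E = kurtosis%:E)%E.
Proof.
rewrite -kurtosisE -(@ge0_expectation1 i (fun x => x ^+ 4))//.
by move=> x; rewrite exprn_even_ge0.
Qed.

Let integrable_x4 i : nu.-integrable setT (EFin \o x4 i).
Proof.
apply/integrableP; split.
  by apply/measurable_EFinP; exact: (measurableT_comp measurable_pow4).
under eq_integral do rewrite /= ger0_norm ?exprn_even_ge0//.
by rewrite expectation_x4 ltry.
Qed.

Let integrable_dom (c : R) (s : seq 'I_n) (F : n.-tuple R -> R) :
  measurable_fun setT F -> (forall t, `|F t| <= c + \sum_(i <- s) x4 i t) ->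
  nu.-integrable setT (EFin \o F).
Proof.
move=> mF Fle.
have intG : nu.-integrable setT (fun t => c%:E + \sum_(i <- s) (EFin \o x4 i) t)%E.
  apply: integrableD => //; first exact: finite_measure_integrable_cst.
  by apply: integrable_sum => // i _; exact: integrable_x4.
apply: le_integrable intG => //; first exact/measurable_EFinP.
move=> t _; rewrite /= sumEFin -EFinD lee_fin; apply: le_trans (Fle t) _.
exact: ler_norm.
Qed.

Let integrable_mono4 (i j k l : 'I_n) : nu.-integrable setT
  (EFin \o (fun t => tnth t i * tnth t j * (tnth t k * tnth t l))).
Proof.
apply: (@integrable_dom 0 [:: i; j; k; l]).
  by do 2 apply: measurable_funM => //; exact: measurable_funM.
move=> t; rewrite !big_cons big_nil /x4.
move: (tnth t i) (tnth t j) (tnth t k) (tnth t l) => a b c d.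
rewrite ler_norml.
have e x : x ^+ 4 = (x * x) ^+ 2 :> R by rewrite -expr2 -exprM.
have h1 := sqr_ge0 (a * b - c * d); have h2 := sqr_ge0 (a * b + c * d).
have h3 := sqr_ge0 (a * a - b * b); have h4 := sqr_ge0 (c * c - d * d).
by rewrite !e; apply/andP; split; nra.
Qed.

Let integrable_mono2 (i j : 'I_n) : nu.-integrable setT
  (EFin \o (fun t => tnth t i * tnth t j)).
Proof.
apply: (@integrable_dom 1 [:: i; j]); first exact: measurable_funM.
move=> t; rewrite !big_cons big_nil /x4.
move: (tnth t i) (tnth t j) => a b; rewrite ler_norml.
have e x : x ^+ 4 = (x * x) ^+ 2 :> R by rewrite -expr2 -exprM.
have h1 := sqr_ge0 (a - b); have h2 := sqr_ge0 (a + b).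
have h3 := sqr_ge0 (a * a - 1); have h4 := sqr_ge0 (b * b - 1).
by rewrite !e; apply/andP; split; nra.
Qed.

Let delta (i j : 'I_n) : R := (i == j)%:R.

Lemma moment2 i j : (\int[nu]_t (tnth t i * tnth t j)%:E = (delta i j)%:E)%E.
Proof.
rewrite /delta; have [<-|ij] := eqVneq i j.
  under eq_integral do rewrite -expr2.
  rewrite (@ge0_expectation1 i (fun x => x ^+ 2)) ?std_normal_second_moment//.
  by move=> x; exact: sqr_ge0.
apply: (@expectation_odd i) => // t.
by rewrite !tnth_flip eqxx eq_sym (negbTE ij) mulNr.
Qed.

(** Isserlis' sum over the three pairings, corrected on the diagonal by the
    difference between the fourth moment and 3. *)
Definition moment4_val (i j k l : 'I_n) : R :=
  delta i j * delta k l + delta i k * delta j l + delta i l * delta j k +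
  (kurtosis - 3) * (delta i j * delta k l * delta i k).

Let moment22 i k : i != k ->
  (\int[nu]_t (tnth t i * tnth t i * (tnth t k * tnth t k))%:E = 1)%E.
Proof.
move=> ik; under eq_integral do rewrite -!expr2.
rewrite (@ge0_expectation2 i k (fun x => x ^+ 2) (fun x => x ^+ 2))//.
- by rewrite std_normal_second_moment mule1.
- by move=> x; exact: sqr_ge0.
- by move=> x; exact: sqr_ge0.
Qed.

Let moment4_odd a i j k l : odd ((i == a) + (j == a) + (k == a) + (l == a)) ->
  (\int[nu]_t (tnth t i * tnth t j * (tnth t k * tnth t l))%:E = 0)%E.
Proof.
move=> oa; apply: (@expectation_odd a) => // t; rewrite !tnth_flip.
move: oa; do 4 case: eqP => _ //=; rewrite ?mulNr ?mulrN ?mulNr ?mulrN ?opprK//.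
Qed.

(** By [expectation_odd] only the monomials whose indices can be paired have a
    nonzero expectation. *)
Lemma moment4 i j k l :
  (\int[nu]_t (tnth t i * tnth t j * (tnth t k * tnth t l))%:E =
   (moment4_val i j k l)%:E)%E.
Proof.
rewrite /moment4_val /delta.
have [<-|ij] := eqVneq i j.
  have [<-|kl] := eqVneq k l.
    have [<-|ik] := eqVneq i k.
      transitivity (kurtosis%:E); last by congr (_%:E); rewrite /=; ring.
      rewrite -(expectation_x4 i); apply: eq_integral => t _.
      by rewrite /x4; congr (_%:E); ring.
    by rewrite moment22//; congr (_%:E); rewrite /=; ring.
  rewrite (@moment4_odd k); last first.
    by rewrite eqxx (eq_sym l k) (negbTE kl); case: (i == k).
  by have [->|ik] := eqVneq i k; rewrite ?(negbTE kl); congr (_%:E); rewrite /=; ring.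
have ji : (j == i) = false by rewrite eq_sym; exact: negbTE.
have [<-|kl] := eqVneq k l.
  rewrite (@moment4_odd i); last by rewrite eqxx ji; case: (k == i).
  by have [<-|ik] := eqVneq i k; rewrite ?ji; congr (_%:E); rewrite /=; ring.
have [<-|ik] := eqVneq i k.
  have [<-|jl] := eqVneq j l.
    transitivity (1%:E : \bar R); last by rewrite ji; congr (_%:E); rewrite /=; ring.
    rewrite -(moment22 ij); apply: eq_integral => t _; congr (_%:E); ring.
  rewrite (@moment4_odd j); last by rewrite eqxx (negbTE ij) (eq_sym l) (negbTE jl).
  by rewrite ji; congr (_%:E); rewrite /=; ring.
have [<-|il] := eqVneq i l.
  have [<-|jk] := eqVneq j k.
    transitivity (1%:E : \bar R); last by congr (_%:E); rewrite /=; ring.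
    rewrite -(moment22 ij); apply: eq_integral => t _; congr (_%:E); ring.
  rewrite (@moment4_odd j); last by rewrite eqxx (negbTE ij) (eq_sym k) (negbTE jk).
  by congr (_%:E); rewrite /=; ring.
rewrite (@moment4_odd i); last first.
  by rewrite eqxx ji (eq_sym k) (negbTE ik) (eq_sym l) (negbTE il).
by congr (_%:E); rewrite /=; ring.
Qed.

Let integrable_lincomb (I : finType) (c : I -> R) (F : I -> n.-tuple R -> R) :
  (forall k, nu.-integrable setT (EFin \o F k)) ->
  nu.-integrable setT (EFin \o (fun t => \sum_k c k * F k t)).
Proof.
move=> intF.
have -> : EFin \o (fun t => \sum_k c k * F k t) =
    (fun t => \sum_k ((c k)%:E * (EFin \o F k) t)%E)%E.
  by apply/funext => t /=; rewrite -sumEFin.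
by apply: integrable_sum => // k _; exact: integrableZl.
Qed.

Let integral_lincomb (I : finType) (c : I -> R) (F : I -> n.-tuple R -> R)
    (m : I -> R) :
  (forall k, nu.-integrable setT (EFin \o F k)) ->
  (forall k, (\int[nu]_t (F k t)%:E = (m k)%:E)%E) ->
  (\int[nu]_t (\sum_k c k * F k t)%:E = (\sum_k c k * m k)%:E)%E.
Proof.
move=> intF mF.
transitivity (\int[nu]_t \sum_k ((c k)%:E * (EFin \o F k) t))%E.
  by apply: eq_integral => t _; rewrite -sumEFin.
rewrite integral_sum//; last by move=> k; exact: integrableZl.
by rewrite -sumEFin; apply: eq_bigr => k _; rewrite integralZl// mF.
Qed.

Lemma expectation_linear_sqr (v : 'cV[R]_n) :
  (\int[nu]_t ((\sum_(i < n) v i 0 * tnth t i) ^+ 2)%:E = (sqn v)%:E)%E.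
Proof.
transitivity (\int[nu]_t (\sum_(p : 'I_n * 'I_n)
   (v p.1 0 * v p.2 0) * (tnth t p.1 * tnth t p.2))%:E)%E.
  apply: eq_integral => t _; congr (_%:E); rewrite expr2 big_distrlr pair_big.
  by apply: eq_bigr => p _ /=; ring.
rewrite (@integral_lincomb _ _ _ (fun p => delta p.1 p.2)).
- congr (_%:E); rewrite sqnE.
  rewrite -(pair_big xpredT xpredT (fun i j => v i 0 * v j 0 * delta i j)) /=.
  apply: eq_bigr => i _; rewrite (bigD1 i)//= big1.
    by rewrite /delta eqxx mulr1 addr0 expr2.
  by move=> j ji; rewrite /delta eq_sym (negbTE ji) mulr0.
- by move=> p; exact: integrable_mono2.
- by move=> p; exact: moment2.
Qed.

(** In the expectation of the squared form, the first pairing of [moment4_val]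
    gives [\tr A ^+ 2], which the centring removes.  The two other pairings give
    the sum of the squared entries each, by symmetry of [A], and the diagonal
    correction is at most [kurtosis] times that sum. *)
Lemma expectation_quadratic_sqr_le (A : 'M[R]_n) : A^T = A ->
  (\int[nu]_t ((\sum_(i < n) \sum_(j < n) A i j * (tnth t i * tnth t j) -
       \tr A) ^+ 2)%:E <=
   ((2 + kurtosis) * \sum_(i < n) \sum_(j < n) A i j ^+ 2)%:E)%E.
Proof.
move=> AT.
have AS i j : A j i = A i j by rewrite -{1}AT mxE.
pose pair2 : finType := ('I_n * 'I_n)%type.
pose a (p : pair2) := A p.1 p.2.
pose mono (p : pair2) (t : n.-tuple R) := tnth t p.1 * tnth t p.2.
pose q t := \sum_p a p * mono p t.
pose q2 t := \sum_(r : pair2 * pair2) (a r.1 * a r.2) * (mono r.1 t * mono r.2 t).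
have qE t : \sum_(i < n) \sum_(j < n) A i j * (tnth t i * tnth t j) = q t.
  by rewrite pair_big.
have q2E t : q t ^+ 2 = q2 t.
  rewrite expr2 /q big_distrlr pair_big /q2.
  by apply: eq_bigr => r _; rewrite mulrACA.
have trE : \sum_p a p * delta p.1 p.2 = \tr A.
  rewrite -(pair_big xpredT xpredT (fun i j => A i j * delta i j)) /=.
  apply: eq_bigr => i _; rewrite (bigD1 i)//= big1 ?addr0 /delta ?eqxx ?mulr1//.
  by move=> j ji; rewrite eq_sym (negbTE ji) mulr0.
pose m4 := \sum_(r : pair2 * pair2) (a r.1 * a r.2) *
   moment4_val r.1.1 r.1.2 r.2.1 r.2.2.
have intq : nu.-integrable setT (EFin \o q).
  by apply: integrable_lincomb => p; exact: integrable_mono2.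
have intq2 : nu.-integrable setT (EFin \o q2).
  by apply: integrable_lincomb => r; exact: integrable_mono4.
have Eq : (\int[nu]_t (q t)%:E = (\tr A)%:E)%E.
  by rewrite (@integral_lincomb _ _ _ (fun p => delta p.1 p.2)) ?trE// => p;
    [exact: integrable_mono2|exact: moment2].
have Eq2 : (\int[nu]_t (q2 t)%:E = m4%:E)%E.
  by rewrite (@integral_lincomb _ _ _
      (fun r : pair2 * pair2 => moment4_val r.1.1 r.1.2 r.2.1 r.2.2))// => r;
    [exact: integrable_mono4|exact: moment4].
have -> : (\int[nu]_t ((\sum_(i < n) \sum_(j < n) A i j * (tnth t i * tnth t j) -
       \tr A) ^+ 2)%:E = (m4 - \tr A ^+ 2)%:E)%E.
  pose F (k : 'I_3) t : R := if k == 0 :> nat then q2 t else if k == 1 :> nat then q t else 1.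
  pose c (k : 'I_3) : R := if k == 0 :> nat then 1 else
     if k == 1 :> nat then - 2 * \tr A else \tr A ^+ 2.
  pose m (k : 'I_3) : R := if k == 0 :> nat then m4 else if k == 1 :> nat then \tr A else 1.
  transitivity (\int[nu]_t (\sum_k c k * F k t)%:E)%E.
    apply: eq_integral => t _; congr (_%:E).
    rewrite qE 3!big_ord_recl big_ord0 /c /F /= -q2E; ring.
  rewrite (@integral_lincomb _ _ _ m).
  - by congr (_%:E); rewrite 3!big_ord_recl big_ord0 /c /m /=; ring.
  - move=> k; rewrite /F; case: (k == 0 :> nat) => //; case: (k == 1 :> nat) => //.
    exact: finite_measure_integrable_cst.
  - move=> k; rewrite /F /m; case: (k == 0 :> nat) => //; case: (k == 1 :> nat) => //.
    by rewrite integral_cst//= probability_setT mule1.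
rewrite lee_fin.
pose sq := \sum_(i < n) \sum_(j < n) A i j ^+ 2.
pose dg := \sum_(i < n) A i i ^+ 2.
have sumd (i : 'I_n) (G : 'I_n -> R) : \sum_(j < n) G j * delta i j = G i.
  rewrite (bigD1 i)//= big1 ?addr0 /delta ?eqxx ?mulr1//.
  by move=> j ji; rewrite eq_sym (negbTE ji) mulr0.
have m4E : m4 = \tr A ^+ 2 + sq + sq + (kurtosis - 3) * dg.
  have row3 i j k : \sum_(l < n) A i j * A k l * moment4_val i j k l =
      A i j * delta i j * A k k + A i j * (A k j * delta i k) +
      A i j * (A k i * delta j k) + (kurtosis - 3) * A i j * delta i j * (A k k * delta i k).
    transitivity (\sum_(l < n) (A i j * delta i j * (A k l * delta k l) +
        A i j * delta i k * (A k l * delta j l) +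
        A i j * delta j k * (A k l * delta i l) +
        (kurtosis - 3) * A i j * delta i j * delta i k * (A k l * delta k l))).
      by apply: eq_bigr => l _; rewrite /moment4_val; ring.
    by rewrite !big_split /= -!mulr_sumr !sumd; ring.
  have row2 i j : \sum_(k < n) \sum_(l < n) A i j * A k l * moment4_val i j k l =
      \tr A * (A i j * delta i j) + A i j ^+ 2 + A i j ^+ 2 +
      (kurtosis - 3) * A i i * (A i j * delta i j).
    rewrite (eq_bigr _ (fun k _ => row3 i j k)) !big_split /= -!mulr_sumr.
    rewrite (sumd i (fun k => A k j)) (sumd j (fun k => A k i)).
    by rewrite (sumd i (fun k => A k k)) (AS i j) /mxtrace; ring.
  have row1 i : \sum_(j < n) \sum_(k < n) \sum_(l < n)
        A i j * A k l * moment4_val i j k l =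
      \tr A * A i i + \sum_(j < n) A i j ^+ 2 + \sum_(j < n) A i j ^+ 2 +
      (kurtosis - 3) * A i i ^+ 2.
    rewrite (eq_bigr _ (fun j _ => row2 i j)) !big_split /= -!mulr_sumr.
    by rewrite (sumd i (A i)); ring.
  rewrite /m4 -(pair_big xpredT xpredT (fun p p' : pair2 =>
    a p * a p' * moment4_val p.1 p.2 p'.1 p'.2)) /=.
  rewrite -(pair_big xpredT xpredT (fun i j => \sum_(p' : pair2)
    A i j * a p' * moment4_val i j p'.1 p'.2)) /=.
  rewrite (eq_bigr (fun i => \tr A * A i i + \sum_(j < n) A i j ^+ 2 +
      \sum_(j < n) A i j ^+ 2 + (kurtosis - 3) * A i i ^+ 2)).
    by rewrite !big_split /= -!mulr_sumr expr2.
  move=> i _; rewrite -row1; apply: eq_bigr => j _.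
  by rewrite -(pair_big xpredT xpredT (fun k l => A i j * A k l * moment4_val i j k l)).
have dg0 : 0 <= dg by apply: sumr_ge0 => i _; exact: sqr_ge0.
have dgsq : dg <= sq.
  apply: ler_sum => i _; rewrite (bigD1 i)//= lerDl.
  by apply: sumr_ge0 => j _; exact: sqr_ge0.
have k0 : 0 <= kurtosis.
  by rewrite fine_ge0// integral_ge0// => x _; rewrite lee_fin exprn_even_ge0.
rewrite m4E -/sq; nra.
Qed.

Lemma kurtosis_ge0 : 0 <= kurtosis.
Proof.
by rewrite fine_ge0// integral_ge0// => x _; rewrite lee_fin exprn_even_ge0.
Qed.

Lemma measurable_linear (v : 'cV[R]_n) :
  measurable_fun setT (fun t : n.-tuple R => \sum_(i < n) v i 0 * tnth t i).
Proof. by apply: measurable_sum => i; exact: measurable_funM. Qed.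

Lemma measurable_quadratic (A : 'M[R]_n) (a : R) :
  measurable_fun setT (fun t : n.-tuple R =>
    \sum_(i < n) \sum_(j < n) A i j * (tnth t i * tnth t j) - a).
Proof.
apply: measurable_funB => //; apply: measurable_sum => i.
apply: measurable_sum => j; apply: measurable_funM => //.
exact: measurable_funM.
Qed.

(** Chebyshev's inequality; the linear and the quadratic part are separated by
    [(a + b) ^+ 2 <= 2 * a ^+ 2 + 2 * b ^+ 2]. *)
Lemma quadratic_tail_le (v : 'cV[R]_n) (A : 'M[R]_n) (h : R) : 0 < h ->
  A^T = A ->
  (nu [set t | (h <= `|\sum_(i < n) v i 0 * tnth t i +
      (\sum_(i < n) \sum_(j < n) A i j * (tnth t i * tnth t j) - \tr A)|)%R] <=
   (2 / h ^+ 2 *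
     (sqn v + (2 + kurtosis) * \sum_(i < n) \sum_(j < n) A i j ^+ 2))%:E)%E.
Proof.
move=> h0 AT.
pose L t := \sum_(i < n) v i 0 * tnth t i.
pose q t := \sum_(i < n) \sum_(j < n) A i j * (tnth t i * tnth t j) - \tr A.
have mL : measurable_fun setT L by exact: measurable_linear.
have mq : measurable_fun setT q by exact: measurable_quadratic.
rewrite -[X in nu X]/[set t | h <= `|L t + q t|]; set E := [set t | _].
have mE : measurable E.
  rewrite -[E]setTI -[X in _ `&` X]/((fun t => `|L t + q t|) @^-1` [set x | h <= x]).
  rewrite -set_itvcy.
  have mn : measurable_fun setT (fun t => `|L t + q t|).
    by apply: measurableT_comp => //; exact: measurable_funD.
  by apply: mn => //; exact: measurable_itv.
have c0 : 0 <= 2 / h ^+ 2 by rewrite divr_ge0// exprn_ge0// ltW.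
apply: (@le_trans _ _
    (\int[nu]_t ((2 / h ^+ 2)%:E * ((L t ^+ 2)%:E + (q t ^+ 2)%:E)))%E).
  rewrite -[X in nu X]setIT -integral_indic//; apply: ge0_le_integral => //.
  - by apply/measurable_EFinP; exact: measurable_indic.
  - apply: measurable_funeM; apply: emeasurable_funD;
      apply/measurable_EFinP; exact: measurable_funX.
  move=> t _; rewrite -EFinD -EFinM lee_fin indicE.
  have r0 : 0 <= 2 / h ^+ 2 * (L t ^+ 2 + q t ^+ 2).
    by rewrite mulr_ge0// addr_ge0// sqr_ge0.
  case: (boolP (t \in E)) => [|_ //]; rewrite inE /E /= => hE.
  rewrite mulrAC ler_pdivlMr ?exprn_gt0// mul1r.
  have : h ^+ 2 <= (L t + q t) ^+ 2.
    by rewrite -(real_normK (num_real (L t + q t))) lerXn2r// nnegrE// ltW.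
  have := sqr_ge0 (L t - q t); lra.
rewrite ge0_integralZl_EFin//; last 2 first.
- by move=> t _; rewrite -EFinD lee_fin addr_ge0// sqr_ge0.
- by apply: emeasurable_funD; apply/measurable_EFinP; exact: measurable_funX.
rewrite [leRHS]EFinM; apply: lee_wpmul2l; first by rewrite lee_fin.
rewrite ge0_integralD//; last 4 first.
- by move=> t _; rewrite lee_fin sqr_ge0.
- by apply/measurable_EFinP; exact: measurable_funX.
- by move=> t _; rewrite lee_fin sqr_ge0.
- by apply/measurable_EFinP; exact: measurable_funX.
rewrite expectation_linear_sqr EFinD; apply: leeD2l.
exact: expectation_quadratic_sqr_le.
Qed.

End normal_vector.

(** * Conditional law of the noise *)

Section conditional_law.
Context {R : realType} {dO : measure_display} {Omega : measurableType dO}.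
Variable P : probability Omega R.

(** A conditional probability given an independent sigma-algebra is constant:
    test it against the events where it exceeds, or falls below, its mean. *)
Lemma cond_prob_independent (G : set (set Omega)) (A : set Omega)
    (g : Omega -> \bar R) :
  G `<=` measurable -> measurable A ->
  (forall w, 0 <= g w <= 1)%E -> cond_prob_version P G A g ->
  (forall B, G B -> P (A `&` B) = P A * P B)%E ->
  {ae P, forall w, g w = P A}.
Proof.
move=> Gm mA g01 [mg Eg] ind.
have gfin w : g w \is a fin_num.
  have /andP[g0 g1] := g01 w.
  by rewrite ge0_fin_numE// (le_lt_trans g1)// ltry.
have mgm : measurable_fun setT g.
  by move=> _ B mB; rewrite setTI; apply: Gm; exact: mg.
have Pfin : P A \is a fin_num by exact: fin_num_measure.
have key B : G B -> (\int[P]_(w in B) g w = \int[P]_(w in B) cst (P A) w)%E.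
  by move=> GB; rewrite Eg// ind// integral_cst//; exact: Gm.
have intg B : measurable B -> P.-integrable B g.
  move=> mB; apply: (@integrableS _ _ _ P setT) => //.
  apply: (@le_integrable _ _ _ P setT _ _ (cst 1%E)) => //.
    move=> w _ /=; have /andP[g0 g1] := g01 w.
    by rewrite gee0_abs// normr1.
  exact: finite_measure_integrable_cst.
have intc B : measurable B -> P.-integrable B (cst (P A)).
  move=> mB; apply: (@integrableS _ _ _ P setT) => //.
  by rewrite -(fineK Pfin); exact: finite_measure_integrable_cst.
have null (B : set Omega) : G B ->
    (forall w, B w -> P A <= g w)%E \/ (forall w, B w -> g w <= P A)%E ->
    {ae P, forall w, B w -> g w = P A}.
  move=> GB sgn; have mB := Gm _ GB.
  have mf : measurable_fun B (fun w => g w - P A)%E.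
    by apply: emeasurable_funB => //; exact: measurable_funTS.
  have : (\int[P]_(w in B) `|g w - P A| = 0)%E.
    case: sgn => h.
      transitivity (\int[P]_(w in B) (g \- cst (P A)) w)%E.
        apply: eq_integral => w; rewrite inE => Bw; rewrite gee0_abs//.
        by rewrite sube_ge0 ?Pfin ?orbT//; exact: h.
      rewrite integralB//; [|exact: intg|exact: intc].
      rewrite key// subee//; apply: integrable_fin_num => //; exact: intc.
    transitivity (\int[P]_(w in B) (cst (P A) \- g) w)%E.
      apply: eq_integral => w; rewrite inE => Bw.
      rewrite lee0_abs; last by rewrite sube_le0; exact: h.
      by rewrite fin_num_oppeB// addeC.
    rewrite integralB//; [|exact: intc|exact: intg].
    rewrite key// subee//; apply: integrable_fin_num => //; exact: intc.
  move=> /(ae_eq_integral_abs _ mB mf); apply: filterS => w /= h Bw.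
  by have /eqP := h Bw; rewrite sube_eq// add0e => /eqP.
have h1 := null (g @^-1` [set y | (P A <= y)%E]).
have h2 := null (g @^-1` [set y | (y <= P A)%E]).
have m1 : measurable [set y | (P A <= y)%E] by rewrite -set_itvcy; exact: emeasurable_itv.
have m2 : measurable [set y | (y <= P A)%E] by rewrite -set_itvNyc; exact: emeasurable_itv.
have {}h1 := h1 (mg _ m1) (or_introl (fun w h => h)).
have {}h2 := h2 (mg _ m2) (or_intror (fun w h => h)).
apply: filterS2 h1 h2 => w k1 k2.
by have /orP[] := le_total (P A) (g w); [exact: k1|exact: k2].
Qed.

End conditional_law.

Section noise_law.
Context {R : realType} {dO : measure_display} {Omega : measurableType dO}.
Variable P : probability Omega R.
Context {dX : measure_display} {X : measurableType dX} {n s : nat}.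
Variables (x : 'I_n -> {RV P >-> X}) (eps : 'I_n -> {RV P >-> R}).
Variable S : Omega -> 'M[R]_(s, n).

Lemma sub_sigma_family (I : Type) dT (T : measurableType dT)
    (Y : I -> Omega -> T) : (forall i, measurable_fun setT (Y i)) ->
  sigma_family Y `<=` measurable.
Proof.
move=> mY; apply: smallest_sub; first exact: sigma_algebra_measurable.
by move=> _ [i _ [B mB <-]]; exact: mY.
Qed.

Lemma measurable_noise : measurable_fun setT (noise eps).
Proof.
apply/measurable_fun_tnthP => i.
rewrite (_ : _ \o _ = eps i) ?measurable_funPT//.
by apply/funext => w; rewrite /= tnth_mktuple.
Qed.

Lemma noise_rect (A : 'I_n -> set R) :
  noise eps @^-1` [set t | forall i, A i (tnth t i)] =
  \bigcap_i ((eps i : Omega -> R) @^-1` A i).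
Proof.
apply/seteqP; split => w /= h i.
  by move=> _; have := h i; rewrite tnth_mktuple.
by rewrite tnth_mktuple; exact: h.
Qed.

Lemma sigma_family_noise_box q :
  sigma_family (fun i => eps i : Omega -> R) (noise eps @^-1` box q).
Proof.
rewrite (noise_rect (fun i => ray (q i))).
pose G := \bigcup_i preimage_set_system setT (eps i : Omega -> R) measurable.
apply: (@fin_bigcap_measurable _ (g_sigma_algebraType G)).
  exact: finite_finset.
move=> i _; apply: sub_sigma_algebra; exists i => //.
by exists (ray (q i)); [exact: measurable_ray|rewrite setTI].
Qed.

(** The noise is independent of the design and of the sketch: almost surely its
    conditional distribution is the standard normal one, simultaneously on the
    countably many boxes and hence on all Borel sets. *)
Lemma cond_noise_std_normal (PX : probability X R)
    (Q : Omega -> probability (n.-tuple R) R) :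
  sampling_model x eps S PX ->
  cond_distribution P (sigma_xS x S) (noise eps) Q ->
  {ae P, forall w, std_normal_vector (Q w)}.
Proof.
move=> [_ iid_eps mS ind] condQ.
pose law : probability (n.-tuple R) R := distribution P (mfun_of measurable_noise).
have lawE A : law A = P (noise eps @^-1` A) by [].
have mbox q : measurable (@box R n q).
  by apply: (@measurable_rect R n (fun i => ray (q i))) => i; exact: measurable_ray.
have std_law : std_normal_vector law.
  by move=> A mA; rewrite lawE noise_rect iid_eps.
have sub : sigma_xS x S `<=` measurable.
  apply: smallest_sub; first exact: sigma_algebra_measurable.
  move=> A [|].
    by apply: sub_sigma_family => i; exact: measurable_funPT.
  by apply: sub_sigma_family => -[j k]; exact: mS.
have mpre q : measurable (noise eps @^-1` box q).
  by rewrite -[X in measurable X]setTI; exact: measurable_noise.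
have aeq q : {ae P, forall w, Q w (box q) = law (box q)}.
  apply: (cond_prob_independent sub (mpre q)) => [w| |B GB].
  - by rewrite measure_ge0 probability_le1.
  - exact: condQ.
  - by rewrite ind//; exact: sigma_family_noise_box.
have : {ae P, forall w, forall k : nat,
    if unpickle k is Some q then Q w (box q) = law (box q) else True}.
  apply: ae_foralln => k; case: (unpickle k) => [q|]; first exact: aeq.
  exact: aeW.
apply: filterS => w h A mA; rewrite -std_law//.
apply: measure_box_unique; last exact: measurable_rect.
  by apply: le_lt_trans (probability_le1 _ measurableT) _; exact: ltry.
by move=> q; have := h (pickle q); rewrite pickleK.
Qed.

End noise_law.

Section type_ab.
Context {R : realType} {dO : measure_display} {Omega : measurableType dO}.
Variable P : probability Omega R.

Lemma expeR_oppe_bounds (a : \bar R) : (0 <= a)%E ->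
  exists2 u : R, expeR (- a) = u%:E & 0 <= u <= 1 /\ ((a < +oo)%E -> 0 < u).
Proof.
case: a => [r|_|//] /=; last first.
  by exists 0; rewrite ?lexx ?ler01//; split.
rewrite lee_fin => r0; exists (expR (- r)) => //.
by rewrite expR_ge0 -[leRHS]expR0 ler_expR oppr_le0; split=> // _; exact: expR_gt0.
Qed.

(** Put [u = exp (- a)] and [v = exp (- b)].  Integrating the conditional
    probability over the event where it is at least [1 - u] gives the lower bound
    [(1 - u) * (1 - v) = 1 - u - v + u * v], and [u * v > 0] when [a] and [b] are
    finite. *)
Lemma ab_type_probability (G : set (set Omega)) (a b : \bar R) (E : set Omega) :
  G `<=` measurable -> (0 <= a)%E -> (0 <= b)%E -> ab_type P G a b E ->
  let p := (1 - expeR (- a) - expeR (- b))%E in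
  (p <= P E)%E /\ ((a < +oo)%E -> (b < +oo)%E -> (p < P E)%E).
Proof.
move=> Gm a0 b0 [mE [g [mg Eg] Pg]] /=.
have [u ua [/andP[u0 u1] up]] := expeR_oppe_bounds a0.
have [v vb [/andP[v0 v1] vp]] := expeR_oppe_bounds b0.
rewrite ua vb in Pg *; rewrite -!EFinB in Pg *.
pose B := g @^-1` [set y | ((1 - u)%:E <= y)%E].
have GB : G B.
  by apply: mg; rewrite -set_itvcy; exact: emeasurable_itv.
have mB := Gm _ GB.
have PE : ((1 - u)%:E * P B <= P E)%E.
  apply: (@le_trans _ _ (P (E `&` B))); last first.
    by apply: le_measure; rewrite ?inE//; exact: measurableI.
  rewrite -(Eg _ GB) -integral_cst//; apply: ge0_le_integral => //.
  - by move=> w _; rewrite lee_fin subr_ge0.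
  - move=> _ C mC; apply: measurableI => //; apply: Gm; exact: mg.
have : (((1 - u) * (1 - v))%:E <= P E)%E.
  apply: le_trans PE; rewrite EFinM; apply: lee_wpmul2l => //.
  by rewrite lee_fin subr_ge0.
move=> h; split => [|/up u0' /vp v0'].
  by apply: le_trans h; rewrite lee_fin; nra.
by apply: lt_le_trans h; rewrite lte_fin; nra.
Qed.

End type_ab.

(** * Power of the test *)

Lemma T_stat_expansion (R : realType) (X : Type) (K : X -> X -> R) n s lam
    (x : 'I_n -> X) (S : 'M[R]_(s, n)) (f : X -> R) (t : n.-tuple R) :
  (0 < n)%N -> (kernel_mx K x)^T = kernel_mx K x ->
  let D := Delta K lam x S in let F := \col_i f (x i) in
  let v := 2 *: (D *m (D *m F)) in
  T_stat K lam x S (response x f t) - mu_stat K lam x S =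
  n%:R^-1 * (sqn (D *m F) + (\sum_(i < n) v i 0 * tnth t i +
   (\sum_(i < n) \sum_(j < n) (D ^+ 2) i j * (tnth t i * tnth t j) -
    \tr (D ^+ 2)))).
Proof.
move=> n0 KT D F v.
have DT : D^T = D := trmx_Delta lam S KT.
pose e : 'cV[R]_n := \col_i tnth t i.
have eE i : e i 0 = tnth t i by rewrite mxE.
have yE : response x f t = F + e.
  by apply/matrixP => i j; rewrite !mxE.
rewrite T_statE// yE /mu_stat [\tr _ / _]mulrC -mulrBr; congr (_ * _).
rewrite mulmxDr {1}/sqn !dotDl !dotDr -/D -/(sqn (D *m F)) -/(sqn (D *m e)).
rewrite (dotC (D *m e)).
have -> : \sum_(i < n) v i 0 * tnth t i = 2 * dot (D *m F) (D *m e).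
  rewrite dotC dot_mulmxl DT dotC -dotZl; apply: eq_bigr => i _.
  by rewrite eE.
have -> : \sum_(i < n) \sum_(j < n) (D ^+ 2) i j * (tnth t i * tnth t j) =
    sqn (D *m e).
  rewrite /sqn dot_mulmxl DT mulmxA; apply: eq_bigr => i _.
  rewrite [(_ *m e) i 0]mxE mulr_sumr; apply: eq_bigr => j _.
  by rewrite !eE -[D ^+ 2]/(D *m D) mulrCA.
ring.
Qed.

Lemma tr_Delta4 (R : realType) n (D : 'M[R]_n) : D^T = D ->
  \tr (D ^+ 4) = \sum_(i < n) \sum_(j < n) (D ^+ 2) i j ^+ 2.
Proof.
move=> DT; have D2T : (D ^+ 2)^T = D ^+ 2.
  by rewrite -[D ^+ 2]/(D *m D) trmx_mul DT.
rewrite (exprD D 2 2) -[_ * _]/(D ^+ 2 *m D ^+ 2).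
apply: eq_bigr => i _; rewrite mxE; apply: eq_bigr => j _.
by rewrite -{2}D2T [(D ^+ 2)^T _ _]mxE expr2.
Qed.

Lemma sqn_le_split (R : realType) n (u v : 'cV[R]_n) :
  sqn u <= 2 * sqn v + 2 * sqn (u - v).
Proof.
rewrite !sqnE !mulr_sumr -big_split; apply: ler_sum => i _ /=.
have -> : (u - v) i 0 = u i 0 - v i 0 by rewrite !mxE.
by move: (u i 0) (v i 0) => a b; have := sqr_ge0 (a - 2 * b); nra.
Qed.

(** A quarter of the squared separation constant: it dominates the bias of the
    smoother, the critical value, and the variances divided by the error
    probability. *)
Definition signal_level (R : realType) (alpha c C e : R) : R :=
  1 + 3 * (1 + 2 * c ^+ 2) * C ^+ 2 +
  2 * `|normal_quantile (1 - alpha / 2)| + (40 + 4 * @kurtosis R) / e.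

Lemma signal_level_ge (R : realType) (alpha c C e : R) : 0 < e ->
  let M := signal_level alpha c C e in
  [/\ 1 <= M, 3 * (1 + 2 * c ^+ 2) * C ^+ 2 <= M,
      2 * `|normal_quantile (1 - alpha / 2)| <= M & 40 + 4 * @kurtosis R <= M * e].
Proof.
move=> e0 /=; have k0 := kurtosis_ge0 (R := R).
have z0 := normr_ge0 (normal_quantile (1 - alpha / 2)).
have ke0 : 0 <= (40 + 4 * @kurtosis R) / e by rewrite divr_ge0 ?ltW//; lra.
have b0 : 0 <= 3 * (1 + 2 * c ^+ 2) * C ^+ 2.
  by rewrite mulr_ge0 ?sqr_ge0// mulr_ge0//; have := sqr_ge0 c; lra.
rewrite -ler_pdivrMr// /signal_level; move: b0 z0 ke0.
set b := 3 * _ * _; set z := `|_|; set k := _ / e => b0 z0 ke0.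
by split; lra.
Qed.

Section power.
Context {R : realType} {X : Type} {H : set (X -> R)}.
Context {ip : (X -> R) -> (X -> R) -> R} {K : X -> X -> R}.
Variables (n s : nat) (lam alpha c C e : R) (x : 'I_n -> X) (S : 'M[R]_(s, n)).
Hypothesis rkhs : is_rkhs H ip K.
Hypotheses (n0 : (0 < n)%N) (nlam : n%:R^-1 < lam) (C0 : 0 <= C) (e0 : 0 < e).
Hypothesis sat : K_satisfiable c lam (kernel_mx K x) S.
Hypothesis unit : sketched_mx K lam x S \in unitmx.

Let D := Delta K lam x S.
Let sigma := sigma_stat K lam x S.
Let M := signal_level alpha c C e.

Let nR : 0 < n%:R :> R. Proof. by rewrite ltr0n. Qed.

Let lam0 : 0 < lam.
Proof. by apply: lt_trans nlam; rewrite invr_gt0. Qed.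

Let sigma0 : 0 <= sigma. Proof. exact: sqrtr_ge0. Qed.

Let signal_ge (f : X -> R) :
  alternatives x H ip C (2 * Num.sqrt M * separation K lam x S) f ->
  M * (lam + sigma) <= n%:R^-1 * sqn (D *m \col_i f (x i)).
Proof.
move=> [Hf fC far].
have [KT _ bias] := Delta_signal rkhs n0 lam0 C0 sat unit Hf fC.
set F := \col_i f (x i) in bias *.
have [M1 Mb _ _] := signal_level_ge alpha c C e0.
rewrite -/M in M1 Mb; set b := 3 * _ * _ in Mb.
have M0 : 0 <= M by exact: le_trans M1.
have d0 : 0 <= lam + sigma by rewrite addr_ge0// ltW.
have far2 : 4 * M * (lam + sigma) <= n%:R^-1 * sqn F.
  rewrite -emp_normE; apply: le_trans (_ : (2 * Num.sqrt M * separation K lam x S) ^+ 2 <= _).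
    by rewrite /separation !exprMn (sqr_sqrtr M0) (sqr_sqrtr d0); lra.
  apply: lerXn2r far; rewrite nnegrE ?sqrtr_ge0//.
  by rewrite mulr_ge0 ?sqrtr_ge0// mulr_ge0 ?sqrtr_ge0.
have split := sqn_le_split F (D *m F).
have in0 : 0 <= n%:R^-1 :> R by rewrite invr_ge0 ltW.
have := ler_wpM2l in0 split; rewrite mulrDr !(mulrCA n%:R^-1) => h.
have bl : C ^+ 2 * (3 * (1 + 2 * c ^+ 2) * lam) = b * lam by rewrite /b; ring.
rewrite bl in bias.
have h1 := ler_wpM2r (ltW lam0) Mb.
have h2 := mulr_ge0 M0 sigma0.
by rewrite -/F -/D in bias h far2 *; move: far2 h1 h2 bias h; set m := M; lra.
Qed.

(** Under the alternative the signal term exceeds the critical value twice over,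
    so the test can only accept if the centred noise term is large. *)
Lemma test_power (nu : probability (n.-tuple R) R) (f : X -> R) :
  std_normal_vector nu ->
  alternatives x H ip C (2 * Num.sqrt M * separation K lam x S) f ->
  ((1 - e)%:E <=
   nu [set t | test K lam x S alpha (response x f t)])%E.
Proof.
move=> std alt; have sig := signal_ge alt.
have [Hf fC _] := alt.
have [KT contr _] := Delta_signal rkhs n0 lam0 C0 sat unit Hf fC.
have DT : D^T = D := trmx_Delta lam S KT.
have expand t := T_stat_expansion lam S f t n0 KT.
rewrite -/D /= in expand.
set F := \col_i f (x i) in sig expand.
set v := 2 *: (D *m (D *m F)) in expand.
pose W (t : n.-tuple R) := \sum_(i < n) v i 0 * tnth t i +
  (\sum_(i < n) \sum_(j < n) (D ^+ 2) i j * (tnth t i * tnth t j) - \tr (D ^+ 2)).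
pose z := normal_quantile (1 - alpha / 2).
pose q := sqn (D *m F).
have testE : [set t | test K lam x S alpha (response x f t)] =
    [set t | z * sigma <= `|n%:R^-1 * (q + W t)|].
  by apply/seteqP; split => t /=; rewrite /test expand.
have mW : measurable_fun setT W.
  apply: measurable_funD; first exact: measurable_linear.
  exact: measurable_quadratic.
have mtest : measurable [set t | test K lam x S alpha (response x f t)].
  rewrite testE -[X in measurable X]setTI.
  rewrite -[X in _ `&` X]/((fun t => `|n%:R^-1 * (q + W t)|) @^-1`
    [set y | z * sigma <= y]) -set_itvcy.
  have mn : measurable_fun setT (fun t => `|n%:R^-1 * (q + W t)|).
    apply: measurableT_comp => //; apply: measurable_funM => //.
    exact: measurable_funD.
  by apply: mn => //; exact: measurable_itv.
have [M1 _ Mz Me] := signal_level_ge alpha c C e0.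
rewrite -/M -/z in M1 Mz Me.
have k0 := kurtosis_ge0 (R := R).
have M0 : 0 < M by exact: lt_le_trans ltr01 M1.
have nsig : n%:R * sigma * M <= q.
  rewrite ler_pdivlMl// in sig; apply: le_trans sig.
  by rewrite -mulrA ler_pM2l// mulrC ler_pM2l// lerDr ltW.
have Mq : M <= q.
  rewrite ler_pdivlMl// in sig; apply: le_trans sig.
  rewrite mulrCA -[leLHS]mulr1 ler_pM2l// mulrDr.
  have n1 : 1 <= n%:R * lam by rewrite mulrC -ler_pdivrMr// mul1r ltW.
  by apply: le_trans n1 _; rewrite lerDl mulr_ge0// ltW.
have q0 : 0 < q by exact: lt_le_trans Mq.
(* acceptance means that the noise cancels at least half of the signal *)
have accept : ~` [set t | test K lam x S alpha (response x f t)] `<=`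
    [set t | q / 2 <= `|W t|].
  rewrite testE => t /= /negP.
  rewrite -ltNge normrM (@ger0_norm _ n%:R^-1) ?invr_ge0 ?(ltW nR)//.
  rewrite ltr_pdivrMl// => acc.
  have zs : n%:R * (z * sigma) <= q / 2.
    have zM : z <= M / 2 by have := ler_norm z; lra.
    have := ler_wpM2r sigma0 zM; move=> /(ler_wpM2l (ltW nR)); lra.
  have := lt_le_trans acc zs; rewrite ltr_norml => /andP[l1 l2].
  by have := ler_norm (- W t); rewrite normrN; lra.
have D2T : (D ^+ 2)^T = D ^+ 2 by rewrite -[D ^+ 2]/(D *m D) trmx_mul DT.
have q20 : 0 < q / 2 by rewrite divr_gt0.
have tail := quadratic_tail_le std v q20 D2T.
have nutest : (nu (~` [set t | test K lam x S alpha (response x f t)]) <= e%:E)%E.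
  apply: (@le_trans _ _ (nu [set t | q / 2 <= `|W t|])).
    apply: le_measure => //; rewrite inE; first exact: measurableC.
    rewrite -[X in measurable X]setTI.
    rewrite -[X in _ `&` X]/((fun t => `|W t|) @^-1` [set y | q / 2 <= y]) -set_itvcy.
    have mn : measurable_fun setT (fun t => `|W t|) by exact: measurableT_comp.
    by apply: mn => //; exact: measurable_itv.
  apply: le_trans tail _; rewrite lee_fin -tr_Delta4//.
  (* the two variances, against the square of the signal *)
  have vq : sqn v <= 4 * q.
    rewrite /v /sqn !dotE mulrA (_ : 2 * 2 = 4); last by ring.
    by rewrite ler_pM2l//; exact: contr.
  have tr4 : \tr (D ^+ 4) = (n%:R * sigma) ^+ 2 / 2.
    have tr0 : 0 <= \tr (D ^+ 4).
      rewrite tr_Delta4//; apply: sumr_ge0 => i _; apply: sumr_ge0 => j _.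
      exact: sqr_ge0.
    rewrite exprMn /sigma /sigma_stat sqr_sqrtr; last first.
      by rewrite divr_ge0 ?mulr_ge0// sqr_ge0.
    by rewrite -/D; field; rewrite gt_eqF.
  rewrite tr4; set r := n%:R * sigma in nsig *.
  have r0 : 0 <= r by rewrite mulr_ge0// ltW.
  clearbody r.
  rewrite mulrAC ler_pdivrMr; last by rewrite exprn_gt0.
  rewrite -(ler_pM2l M0).
  have rM : M * r ^+ 2 <= q ^+ 2.
    have h1 : (r * M) ^+ 2 <= q ^+ 2.
      by apply: lerXn2r nsig; rewrite nnegrE ?mulr_ge0// ltW.
    apply: le_trans h1; rewrite exprMn (mulrC M) (expr2 M).
    by rewrite (mulrA (r ^+ 2)) ler_peMr// mulr_ge0 ?sqr_ge0// ltW.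
  have qM : M * q <= q ^+ 2 by rewrite expr2 ler_pM2r.
  have := ler_wpM2r (sqr_ge0 q) Me.
  have kr := ler_wpM2l k0 rM.
  have vM := ler_wpM2l (ltW M0) vq.
  nra.
rewrite -[X in nu X]setCK probability_setC; last exact: measurableC.
by rewrite EFinB; apply: leeB.
Qed.

End power.

Theorem theorem4p6 (R : realType) (d : nat) (hd : (0 < d)%N)
  (dX : measure_display) (X : measurableType dX) (emb : X -> d.-tuple R)
  (hX : subspace_of_Rd emb)
  (PX : probability X R) (H : set (X -> R))
  (ip : (X -> R) -> (X -> R) -> R) (K : X -> X -> R)
  (mu : nat -> R) (phi : nat -> X -> R)
  (hK : kernel_model PX H ip K mu phi)
  (hA1 : assumption_A1 mu phi) :
  exists2 delta0 : R, 0 < delta0 &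
  forall delta : R, delta0 <= delta ->
  forall (dO : measure_display) (Omega : measurableType dO)
    (P : probability Omega R)
    (s : nat -> nat) (lam : nat -> R)
    (x : forall n : nat, 'I_n -> {RV P >-> X})
    (eps : forall n : nat, 'I_n -> {RV P >-> R})
    (S : forall n : nat, Omega -> 'M[R]_(s n, n))
    (Q : forall n : nat, Omega -> probability (n.-tuple R) R)
    (alpha C c : R) (c1 c2 : \bar R),
  0 < alpha < 1 -> 0 < C -> 0 < c -> (0 < c1)%E -> (0 < c2)%E ->
  (forall n : nat, sampling_model (x n) (eps n) (S n) PX) ->
  (forall n : nat,
     cond_distribution P (sigma_xS (x n) (S n)) (noise (eps n)) (Q n)) ->
  (\forall n \near \oo, {ae P, forall w : Omega,
     sketched_mx K (lam n) (sample (x n) w) (S n w) \in unitmx}) ->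
  (\forall n \near \oo, n%:R^-1 < lam n) ->
  lam n @[n --> \oo] --> (0 : R) ->
  (\forall n \near \oo, delta * (first_le mu (lam n))%:R <= (s n)%:R) ->
  (\forall n \near \oo,
     ab_type P (sigma_x (x n))
       (c1 * (s n)%:R%:E)%E (c2 * (first_le mu (lam n))%:R%:E)%E
       [set w | K_satisfiable c (lam n)
                  (kernel_mx K (sample (x n) w)) (S n w)]) ->
  forall e : R, 0 < e ->
  exists (Ce : R) (Ne : nat), [/\ 0 < Ce, (0 < Ne)%N &
  forall n : nat, (Ne <= n)%N ->
  exists E : set Omega,
    let p := (1 - expeR (- (c1 * (s n)%:R%:E))
                - expeR (- (c2 * (first_le mu (lam n))%:R%:E)))%E in
    [/\ measurable E,
        (p <= P E)%E,
        (c1 < +oo)%E -> (c2 < +oo)%E -> (p < P E)%E &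
        forall w : Omega, E w ->
        ((1 - e)%:E <=
         ereal_inf [set cond_power (x n) (S n) K (lam n) alpha (Q n) f w
                   | f in alternatives (sample (x n) w) H ip C
                       (Ce * separation K (lam n) (sample (x n) w) (S n w))%R])%E]].
Proof.
exists 1 => // delta _ dO Omega P s lam x eps S Q alpha C c c1 c2 _ C0 c0 c10 c20.
move=> model condQ unit nlam _ _ ab e e0.
have [M1 _ _ _] := signal_level_ge alpha c C e0.
set M := signal_level alpha c C e in M1.
have [N _ hN] : \forall n \near \oo, [/\
    {ae P, forall w, sketched_mx K (lam n) (sample (x n) w) (S n w) \in unitmx},
    n%:R^-1 < lam n &
    ab_type P (sigma_x (x n))
       (c1 * (s n)%:R%:E)%E (c2 * (first_le mu (lam n))%:R%:E)%E
       [set w | K_satisfiable c (lam n)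
                  (kernel_mx K (sample (x n) w)) (S n w)]].
  by move: unit nlam ab; apply: filterS3.
exists (2 * Num.sqrt M), (maxn N 1); split.
- by rewrite mulr_gt0// sqrtr_gt0 (lt_le_trans ltr01).
- by rewrite leq_max orbT.
move=> n; rewrite geq_max => /andP[Nn n0].
have [unitn nlamn abn] := hN n Nn.
have stdn := cond_noise_std_normal (model n) (condQ n).
have [N0 [mN0 N00 subN0]] : {ae P, forall w,
    sketched_mx K (lam n) (sample (x n) w) (S n w) \in unitmx /\
    std_normal_vector (Q n w)}.
  by apply: filterS2 unitn stdn => w; split.
set A := [set w | K_satisfiable _ _ _ _] in abn.
have mA : measurable A by case: abn.
have PE : P (A `\` N0) = P A.
  rewrite [RHS](measureDI P mA mN0) [X in (_ + X)%E](_ : _ = 0%E) ?adde0//.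
  by apply: (subset_measure0 _ mN0) => //; exact: measurableI.
have nng (a : \bar R) (k : nat) : (0 < a)%E -> (0 <= a * k%:R%:E)%E.
  by move=> a0; rewrite mule_ge0 ?lee_fin// ltW.
have fin (a : \bar R) (k : nat) : (0 < a)%E -> (a < +oo)%E -> (a * k%:R%:E < +oo)%E.
  by move=> a0 aoo; rewrite lte_mul_pinfty ?ltry ?ltW// ge0_fin_numE// ltW.
have sub : sigma_x (x n) `<=` measurable.
  by apply: sub_sigma_family => i; exact: measurable_funPT.
have [ple plt] := ab_type_probability sub (nng _ _ c10) (nng _ _ c20) abn.
exists (A `\` N0); split.
- exact: measurableD.
- by rewrite PE.
- by move=> c1oo c2oo; rewrite PE; apply: plt; exact: fin.
move=> w [Aw N0w].
have [uw sw] : sketched_mx K (lam n) (sample (x n) w) (S n w) \in unitmx /\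
    std_normal_vector (Q n w).
  by apply: contrapT => h; apply: N0w; exact: subN0.
have rkhs : is_rkhs H ip K by case: hK => -[].
apply: le_ereal_inf_tmp => _ [f alt <-].
exact: (test_power rkhs n0 nlamn (ltW C0) e0 Aw uw sw alt).
Qed.
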